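(* Let $\mathbb{F}$ be any field, let $m$ be a growing parameter and let $\Delta=\Delta(m)\geq 1$ be an integer-valued function of $m$ with $\Delta = m^{o(1)}$. Let $P^{(\Delta)}\in\mathbb{F}[X^{(\Delta)}]$ be the polynomial defined in the context, on $n_\Delta = 8(2m)^\Delta$ variables. Then any multilinear circuit of product-depth $\Delta$ computing $P^{(\Delta)}$ must have size at least $\exp(m^{\Omega(1)}) = \exp\big(n_\Delta^{\Omega(1/\Delta)}\big)$.
   Context: Polynomials: $X^{(0)}=\{x_{i,j}: i\in[4], j\in[2]\}$ and $P^{(0)} = \sum_{i_1\in\{1,2\},\, i_2\in\{3,4\}} x_{i_1,1}x_{i_1,2}x_{i_2,1}x_{i_2,2}$. For $\Delta\geq 0$, $X^{(\Delta+1)}$ is the disjoint union of $2m$ disjoint copies $X^{(\Delta+1)}_{i,j}$ ($i\in[m]$, $j\in[2]$) of $X^{(\Delta)}$, and $P^{(\Delta+1)}(X^{(\Delta+1)}) = \prod_{i\in[m]}\big(P^{(\Delta)}(X^{(\Delta+1)}_{i,1}) + P^{(\Delta)}(X^{(\Delta+1)}_{i,2})\big)$, where $P^{(\Delta)}(X^{(\Delta+1)}_{i,j})$ denotes the copy of $P^{(\Delta)}$ on the variables $X^{(\Delta+1)}_{i,j}$. Thus $|X^{(\Delta)}| = n_\Delta = 8(2m)^\Delta$. Circuits: algebraic circuits over $\mathbb{F}$ with sum and product gates of unbounded fan-in; size is the number of gates (including input gates); product-depth is the maximum number of product gates on any path from an input gate to the output gate. A circuit is multilinear if every gate computes a multilinear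 polynomial (degree at most $1$ in each variable). *)

(* Defs.v *)
From HB Require Import structures.
From mathcomp Require Import all_boot all_order all_algebra.
From mathcomp Require Import mpoly.

Set Implicit Arguments.
Unset Strict Implicit.
Unset Printing Implicit Defensive.

Import GRing.Theory.

Local Open Scope ring_scope.

(* A gate names the gates feeding it by their positions in the circuit.
   A sum gate computes a linear combination of its children: the wires entering
   it carry scalars, as is usual for bounded-depth circuits over a field.  The
   ordinary sum gate is the case where all the scalars are 1. *)
Inductive gate (F : fieldType) (n : nat) : Type :=
| GVar of 'I_n
| GConst of F
| GSum of seq (F * nat)
| GProd of seq nat.

Section Circuits.
Variables (F : fieldType) (n : nat).

Definition children (g : gate F n) : seq nat :=
  match g with
  | GVar _ | GConst _ => [::]
  | GSum s => [seq e.2 | e <- s]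
  | GProd s => s
  end.

Definition is_input (g : gate F n) : bool :=
  match g with GVar _ | GConst _ => true | _ => false end.

Definition is_prod (g : gate F n) : bool :=
  if g is GProd _ then true else false.

(* The gates of the underlying directed acyclic graph are listed in a
   topological order: children come strictly before their parents.  The
   in-degree 0 gates are exactly the input gates. *)
Definition well_formed (gs : seq (gate F n)) : bool :=
  all (fun i => let g := nth (GConst n 0) gs i in
         all (fun j => j < i)%N (children g)
         && (is_input g || (children g != [::])))
      (iota 0 (size gs)).

Record circuit : Type := Circuit {
  gates : seq (gate F n);
  output : nat;
  gates_wf : well_formed gates;
  output_lt : (output < size gates)%N
}.

Definition circuit_size (C : circuit) : nat := size (gates C).

Definition gate_at (C : circuit) (i : nat) : gate F n :=
  nth (GConst n 0) (gates C) i.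

(* The polynomial of a gate, given the list [vs] of those of earlier gates. *)
Definition gate_poly (vs : seq {mpoly F[n]}) (g : gate F n) : {mpoly F[n]} :=
  match g with
  | GVar k => 'X_k
  | GConst c => c%:MP
  | GSum s => \sum_(e <- s) e.1 *: vs`_(e.2)
  | GProd s => \prod_(j <- s) vs`_j
  end.

Definition circuit_polys (C : circuit) : seq {mpoly F[n]} :=
  foldl (fun vs g => rcons vs (gate_poly vs g)) [::] (gates C).

Definition computes (C : circuit) (p : {mpoly F[n]}) : Prop :=
  (circuit_polys C)`_(output C) = p.

Definition multilinear (p : {mpoly F[n]}) : Prop :=
  forall (mon : 'X_{1..n}) (i : 'I_n), mon \in msupp p -> (mon i <= 1)%N.

Definition multilinear_circuit (C : circuit) : Prop :=
  forall p, p \in circuit_polys C -> multilinear p.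

Definition wire (C : circuit) : rel nat :=
  fun i j => i \in children (gate_at C j).

Definition product_depth_le (C : circuit) (d : nat) : Prop :=
  forall (i : nat) (s : seq nat),
    is_input (gate_at C i) -> path (wire C) i s -> last i s = output C ->
    (count (fun j => is_prod (gate_at C j)) (i :: s) <= d)%N.

End Circuits.

(* In [Xvar m D.+1] the variable [(i, j, x)] is the one corresponding to [x] in
   the [(i, j)]-th copy of [Xvar m D]. *)
Fixpoint Xvar (m D : nat) : finType :=
  match D with
  | 0 => ('I_4 * 'I_2)%type
  | D'.+1 => ('I_m * 'I_2 * Xvar m D')%type
  end.

Lemma card_Xvar m D : #|Xvar m D| = (8 * (2 * m) ^ D)%N.
Proof.
elim: D => [|D IH] /=; first by rewrite card_prod !card_ord.
by rewrite !card_prod !card_ord IH expnS mulnCA (mulnC m).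
Qed.

Section HardPoly.
Variables (F : fieldType) (m : nat).

Definition xvar (D : nat) (x : Xvar m D) : {mpoly F[#|Xvar m D|]} :=
  'X_(enum_rank x).

Definition copy_poly (D : nat) (i : 'I_m) (j : 'I_2)
    (p : {mpoly F[#|Xvar m D|]}) : {mpoly F[#|Xvar m D.+1|]} :=
  p \mPo [tuple @xvar D.+1 (i, j, enum_val k) | k < #|Xvar m D|].

(* Indices are shifted to start at 0, so {1,2} and {3,4} are {0,1} and {2,3}. *)
Definition P0 : {mpoly F[#|Xvar m 0|]} :=
  let x (i : 'I_4) (j : 'I_2) := @xvar 0 (i, j) in
  \sum_(i1 < 4 | (i1 < 2)%N) \sum_(i2 < 4 | (2 <= i2)%N)
     x i1 0 * x i1 1 * x i2 0 * x i2 1.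

Fixpoint Ppoly (D : nat) : {mpoly F[#|Xvar m D|]} :=
  match D with
  | 0 => P0
  | D'.+1 => \prod_(i < m)
      (copy_poly i 0 (Ppoly D') + copy_poly i 1 (Ppoly D'))
  end.

End HardPoly.

(* Main.v *)
(* The random restriction of P^(D) treats the factors of the product independently.
   In factor i, with probability 1/2 the second summand is set to 0 and the first
   one is restricted recursively; otherwise the factor becomes y + z, where y is a
   uniformly random leaf of the first summand and z a fixed leaf of the second one.
   At the bottom P^(0) becomes (x + x')(y + y'). Whatever the choices, the restricted
   polynomial is a product of sums y + z on disjoint pairs, so the matrix of its
   values at Boolean points, with rows indexed by the y's and columns by the z's,
   has full rank: its relative rank (the rank divided by sqrt 2 to the number of
   live variables) is 1.

   The relative rank is subadditive, submultiplicative over products of factors in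
   disjoint variables, and at most 2^(-1/2) when the number of live variables is
   odd. Follow a circuit from the output downwards, keeping a class S of variables
   whose total density in the surviving copies of P^(D) is at least 1/2. A product
   gate splits S into classes, and one of three things happens, with t = sqrt m.
   If some class has a large total density (at least t) in the subblocks, or if
   many subblocks lie almost entirely in a single class, then except with
   probability exp(-Omega(t)) some class again has density at least 1/2 in the
   surviving subblocks, and one recurses into the corresponding factor, which has
   smaller product-depth. Otherwise many subblocks are split between classes of
   small load, and the random leaves make the number of live variables of many
   classes odd: the expected relative rank is exp(-Omega(t)). At product-depth 0 the
   factors are affine and have rank at most 2. So a circuit of size s has expected
   relative rank at most (2 s)^Delta exp(-Omega(t)), which must be at least 1. *)
Require Import Defs.
From mathcomp Require Import all_boot all_order all_algebra.
From mathcomp Require mpoly.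
From mathcomp Require Import ring lra zify.

Set Implicit Arguments.
Unset Strict Implicit.
Unset Printing Implicit Defensive.

Import Order.TTheory GRing.Theory Num.Theory.

Local Open Scope ring_scope.

(** * Rank of evaluation matrices *)

Section MatrixRank.
Variable F : fieldType.

Lemma mxrank_sum_mul_le (m n : nat) (I : finType)
    (g : 'I_m -> I -> F) (h : I -> 'I_n -> F) :
  (\rank (\matrix_(i, j) (\sum_k g i k * h k j)%R) <= #|I|)%N.
Proof.
have -> : \matrix_(i, j) \sum_k g i k * h k j =
    (\matrix_(i < m, k < #|I|) g i (enum_val k)) *m
    (\matrix_(k < #|I|, j < n) h (enum_val k) j).
  apply/matrixP => i j; rewrite !mxE (reindex _ (onW_bij _ (enum_val_bij I))) /=.
  by apply: eq_bigr => k _; rewrite !mxE.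
by apply: leq_trans (mxrankM_maxl _ _) _; apply: rank_leq_col.
Qed.

Lemma mxrank_sum_le (m n : nat) (I : finType) (B : I -> 'M[F]_(m, n)) :
  (\rank (\sum_i B i)%R <= \sum_i \rank (B i))%N.
Proof.
apply: (big_rec2 (fun A r => \rank A <= r)%N); first by rewrite mxrank0.
move=> i r A _ Ar; apply: leq_trans (mxrank_add _ _) _.
by rewrite leq_add2l.
Qed.

(** Multiplying out rank factorizations of [A] and [B] gives one rank-one term for each pair of
    terms. *)
Lemma mxrank_hadamard (m n : nat) (A B : 'M[F]_(m, n)) :
  (\rank (\matrix_(i, j) (A i j * B i j)%R) <= \rank A * \rank B)%N.
Proof.
have -> : \matrix_(i, j) (A i j * B i j) = \matrix_(i, j)
    \sum_(k : 'I_(\rank A) * 'I_(\rank B))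
      (col_base A i k.1 * col_base B i k.2) *
      (row_base A k.1 j * row_base B k.2 j).
  apply/matrixP => i j; rewrite !mxE -{1}(mulmx_base A) -{1}(mulmx_base B) !mxE.
  rewrite big_distrlr /= pair_bigA; apply: eq_bigr => k _ /=.
  by rewrite mulrACA.
apply: leq_trans (mxrank_sum_mul_le _ _) _.
by rewrite card_prod !card_ord.
Qed.

End MatrixRank.

Section EvaluationRank.
Variables (F : fieldType) (X : finType).

Definition bpoint := {ffun X -> bool}.

(* [inl c] fixes a variable to the constant [c]; [inr true] and [inr false]
   keep it alive on the row side and on the column side. *)
Definition status := (bool + bool)%type.

Implicit Types (rho : X -> status) (S : pred X) (phi : bpoint -> F).

Definition combine rho (a b : bpoint) : bpoint :=
  [ffun x => match rho x with
             | inl c => c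
             | inr true => a x
             | inr false => b x
             end].

Definition evmx rho phi : 'M[F]_#|{: bpoint}| :=
  \matrix_(i, j) phi (combine rho (enum_val i) (enum_val j)).

Lemma rank_evmx_scale rho phi c :
  (\rank (evmx rho (fun p => (c * phi p)%R)) <= \rank (evmx rho phi))%N.
Proof.
have -> : evmx rho (fun p => c * phi p) = c *: evmx rho phi.
  by apply/matrixP => i j; rewrite !mxE.
exact: mxrank_scale.
Qed.

Lemma rank_evmx_sum rho (I : finType) (phi : I -> bpoint -> F) :
  (\rank (evmx rho (fun p => (\sum_i phi i p)%R)) <=
   \sum_i \rank (evmx rho (phi i)))%N.
Proof.
apply: leq_trans (mxrank_sum_le _); rewrite eq_leq //; congr (\rank _).
apply/matrixP => i j; rewrite mxE summxE.
by apply: eq_bigr => k _; rewrite mxE.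
Qed.

Lemma rank_evmx_prod rho (I : finType) (phi : I -> bpoint -> F) :
  (\rank (evmx rho (fun p => (\prod_i phi i p)%R)) <=
   \prod_i \rank (evmx rho (phi i)))%N.
Proof.
elim: (index_enum I) => [|k s IH].
  have -> : evmx rho (fun p => \prod_(i <- [::]) phi i p) =
      \matrix_(i, j) \sum_(k : unit) (fun _ _ => 1) i k * (fun _ _ => 1) k j.
    by apply/matrixP => i j; rewrite !mxE big_nil sumr_const card_unit mulr1.
  by rewrite big_nil; apply: leq_trans (mxrank_sum_mul_le _ _) _; rewrite card_unit.
rewrite big_cons; apply: leq_trans (leq_mul (leqnn _) IH).
apply: leq_trans (mxrank_hadamard _ _); rewrite eq_leq //; congr (\rank _).
by apply/matrixP => i j; rewrite !mxE big_cons.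
Qed.

Definition depends_on S phi :=
  forall p q : bpoint, (forall x, S x -> p x = q x) -> phi p = phi q.

Definition side rho S s := (\sum_(x | S x) (rho x == inr s))%N.

Lemma card_side rho S s : side rho S s = #|[pred x | S x && (rho x == inr s)]|.
Proof. by rewrite /side -sum1_card [RHS]big_mkcondr. Qed.

(** A row depends only on the live row-side variables of [S], so the matrix factors through their
    Boolean assignments; columns are symmetric. *)
Lemma rank_evmx_side rho S phi s : depends_on S phi ->
  (\rank (evmx rho phi) <= 2 ^ side rho S s)%N.
Proof.
move=> phiS; pose Y := {x | S x && (rho x == inr s)}.
pose ext (k : {ffun Y -> bool}) : bpoint :=
  [ffun x => if insub x is Some y then k y else false].
pose res (p : bpoint) : {ffun Y -> bool} := [ffun y => p (val y)].
have extK p x : S x -> rho x = inr s -> ext (res p) x = p x.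
  move=> Sx rx; rewrite ffunE; case: insubP => [y _ yx|]; last by rewrite Sx rx eqxx.
  by rewrite ffunE yx.
have cardY : #|{: {ffun Y -> bool}}| = (2 ^ side rho S s)%N.
  by rewrite card_ffun card_bool card_sig card_side.
rewrite -cardY; case: s @Y @ext @res extK cardY => Y ext res extK cardY.
- have -> : evmx rho phi = \matrix_(i, j) \sum_(k : {ffun Y -> bool})
      (res (enum_val i) == k)%:R * phi (combine rho (ext k) (enum_val j)).
    apply/matrixP => i j; rewrite !mxE (bigD1 (res (enum_val i))) //=.
    rewrite eqxx mul1r big1 ?addr0; last first.
      by move=> k; rewrite eq_sym => /negPf ->; rewrite mul0r.
    apply: phiS => x Sx; rewrite !ffunE; case rx: (rho x) => [//|[]//].
    by rewrite -(extK (enum_val i)) // ffunE.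
  exact: mxrank_sum_mul_le.
- have -> : evmx rho phi = \matrix_(i, j) \sum_(k : {ffun Y -> bool})
      phi (combine rho (enum_val i) (ext k)) * (res (enum_val j) == k)%:R.
    apply/matrixP => i j; rewrite !mxE (bigD1 (res (enum_val j))) //=.
    rewrite eqxx mulr1 big1 ?addr0; last first.
      by move=> k; rewrite eq_sym => /negPf ->; rewrite mulr0.
    apply: phiS => x Sx; rewrite !ffunE; case rx: (rho x) => [//|[]//].
    by rewrite -(extK (enum_val j)) // ffunE.
  exact: (mxrank_sum_mul_le (fun i k => phi (combine rho (enum_val i) (ext k)))).
Qed.

Definition affine_on S phi := exists c (l : X -> F),
  forall p, phi p = c + \sum_(x | S x) l x * (p x)%:R.

(** Constants and row variables form one rank-one term, column variables the other. *)
Lemma rank_evmx_affine rho S phi : affine_on S phi ->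
  (\rank (evmx rho phi) <= 2)%N.
Proof.
case=> c [l phiE].
pose live s x := S x && (rho x == inr s).
pose g (a : bpoint) (k : bool) : F :=
  if k then c + \sum_(x | S x) (if rho x is inl d then l x * d%:R else 0)
            + \sum_(x | live true x) l x * (a x)%:R else 1.
pose h (k : bool) (b : bpoint) : F :=
  if k then 1 else \sum_(x | live false x) l x * (b x)%:R.
have -> : evmx rho phi = \matrix_(i, j) \sum_(k : bool)
    g (enum_val i) k * h k (enum_val j).
  apply/matrixP => i j; rewrite !mxE big_bool /= mulr1 mul1r phiE -!addrA.
  congr (_ + _); rewrite !big_mkcondr -!big_split /=.
  apply: eq_bigr => x _; rewrite ffunE.
  by case: (rho x) => [d|[]] /=; rewrite ?eqxx ?addr0 ?add0r.
apply: leq_trans (mxrank_sum_mul_le (fun i => g (enum_val i)) _) _.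
by rewrite card_bool.
Qed.

(* The matrix is the [size ps]-th Kronecker power of [[0, 1], [1, 2]], whose
   determinant is [-1] in every characteristic. *)
Lemma rank_evmx_pairs rho phi (ps : seq (X * X)) :
  uniq (unzip1 ps) -> uniq (unzip2 ps) ->
  (forall a b, phi (combine rho a b) =
     \prod_(yz <- ps) ((a yz.1)%:R + (b yz.2)%:R)) ->
  (2 ^ size ps <= \rank (evmx rho phi))%N.
Proof.
move=> u1 u2 phiE; pose N := size ps; pose I := {ffun 'I_N -> bool}.
pose emb (t : seq X) (al : I) : bpoint :=
  [ffun x => if insub (index x t) is Some j then al j else false].
have embE t al x0 (j : 'I_N) : uniq t -> size t = N -> emb t al (nth x0 t j) = al j.
  by move=> ut st; rewrite ffunE index_uniq ?st // valK.
pose m (x y : bool) : F := x%:R + y%:R.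
pose mi (x y : bool) : F := if x then (if y then 0 else 1) else (if y then 1 else - 2).
have mmi x y : \sum_z m x z * mi z y = (x == y)%:R.
  by rewrite big_bool /m /mi; case: x y => [] [] /=;
    rewrite ?mulr1n ?mulr0n; ring.
have phiEm (al be : I) :
    phi (combine rho (emb (unzip1 ps) al) (emb (unzip2 ps) be)) =
    \prod_(j < N) m (al j) (be j).
  rewrite phiE; case: ps @N @I @emb embE u1 u2 phiE al be => [|p0 ps'] N I emb embE u1 u2 phiE al be.
    by rewrite big_nil big_ord0.
  rewrite (big_nth p0) big_mkord; apply: eq_bigr => j _.
  rewrite -(nth_map _ p0.1 fst) ?ltn_ord // -(nth_map _ p0.2 snd) ?ltn_ord //.
  by rewrite !embE ?size_map.
(* [U] selects rows; [V] selects columns and combines them by the Kronecker power of [mi], the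
   inverse of the 2 by 2 matrix [m]. Hence multiplying by [U] and [V] yields an identity matrix. *)
pose U : 'M[F]_(#|{: I}|, #|{: bpoint}|) :=
  \matrix_(i, j) (enum_val j == emb (unzip1 ps) (enum_val i))%:R.
pose V : 'M[F]_(#|{: bpoint}|, #|{: I}|) :=
  \matrix_(i, j) \sum_(be : I) (enum_val i == emb (unzip2 ps) be)%:R *
     \prod_j0 mi (be j0) ((enum_val j : I) j0).
have pick1 (q : bpoint) (f : bpoint -> F) :
    \sum_(k < #|{: bpoint}|) (enum_val k == q)%:R * f (enum_val k) = f q.
  rewrite (bigD1 (enum_rank q)) //= enum_rankK eqxx mul1r big1 ?addr0 // => k kq.
  rewrite (_ : (_ == _) = false) ?mul0r //; apply/negbTE; apply: contra kq.
  by move=> /eqP <-; rewrite enum_valK.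
have UMV : U *m evmx rho phi *m V = 1%:M.
  apply/matrixP => i j; rewrite -mulmxA mxE.
  under eq_bigr => k _ do rewrite mxE.
  pose W (p : bpoint) : F := \sum_(k < #|{: bpoint}|)
    phi (combine rho p (enum_val k)) * V k j.
  under eq_bigr => k _.
    rewrite [X in _ * X](_ : _ = W (enum_val k)); last first.
      by rewrite mxE; apply: eq_bigr => k' _; rewrite mxE.
    over.
  rewrite pick1 /W.
  under eq_bigr => k _ do rewrite mxE mulr_sumr.
  rewrite exchange_big /=.
  under eq_bigr => be _.
    under eq_bigr => k _ do rewrite mulrCA.
    rewrite (pick1 _ (fun q => phi (combine rho _ q) * _)) phiEm -big_split /=.
    over.
  rewrite -(bigA_distr_bigA (fun j0 x => m ((enum_val i : I) j0) x *
     mi x ((enum_val j : I) j0))) /=.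
  under eq_bigr => j0 _ do rewrite mmi.
  rewrite mxE; case: eqP => [->|ij]; first by rewrite big1 // => j0 _; rewrite eqxx.
  have [j0 nj0] : exists j0, (enum_val i : I) j0 != (enum_val j : I) j0.
    apply/existsP; rewrite -negb_forall; apply: contra_notN ij => /forallP h.
    by apply: enum_val_inj; apply/ffunP => j0; apply/eqP.
  by rewrite (bigD1 j0) //= (negPf nj0) mul0r.
have <- : #|{: I}| = (2 ^ size ps)%N by rewrite card_ffun card_bool card_ord.
rewrite -[X in (X <= _)%N](mxrank1 F) -UMV.
by apply: leq_trans (mxrankM_maxl _ _) (mxrankM_maxr _ _).
Qed.

End EvaluationRank.

(** * Sums of products over partitions of the variables *)

Section Level.
Variables (F : fieldType) (X : finType).

(* [level s d S phi]: semantic counterpart of a multilinear circuit of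
   product-depth [d] on the variables of [S]. The factors of a product live on
   the colour classes of a partition of [S], and each sum has at most [s]
   terms. *)
Fixpoint level (s d : nat) (S : pred X) (phi : bpoint X -> F) : Prop :=
  match d with
  | 0 => affine_on S phi
  | d'.+1 => exists (c : 'I_s -> F) (n : 'I_s -> nat)
      (col : forall j, X -> 'I_(n j)) (psi : forall j, 'I_(n j) -> bpoint X -> F),
      (forall p, phi p = \sum_j c j * \prod_k psi j k p) /\
      (forall j k, level s d' (fun x => S x && (col j x == k)) (psi j k))
  end.

Lemma affine_depends S (phi : bpoint X -> F) : affine_on S phi -> depends_on S phi.
Proof.
move=> [c [l E]] p q pq; rewrite !E; congr (_ + _).
by apply: eq_bigr => x Sx; rewrite pq.
Qed.

Lemma level_depends s d S (phi : bpoint X -> F) : level s d S phi -> depends_on S phi.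
Proof.
elim: d S phi => [|d IH] S phi; first exact: affine_depends.
move=> [c [n [col [psi [E H]]]]] p q pq; rewrite !E; apply: eq_bigr => j _.
congr (_ * _); apply: eq_bigr => k _; apply: (IH _ _ (H j k)) => x /andP[Sx _].
exact: pq.
Qed.

End Level.

(** * The random restriction *)

Section Restriction.
Variable n : nat.

(** A leaf takes the first summand at every level and ends at a variable of [P0] with second index
    0. Densities are measured on leaves only. *)
Fixpoint leaf (D : nat) : finType :=
  match D with 0 => 'I_4 | D'.+1 => ('I_n.+1 * leaf D')%type end.

Fixpoint leaf0 (D : nat) : leaf D :=
  match D return leaf D with 0 => 0 | D'.+1 => (0, leaf0 D') end.

Fixpoint leafvar (D : nat) : leaf D -> Xvar n.+1 D :=
  match D return leaf D -> Xvar n.+1 D with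
  | 0 => fun i => (i, 0)
  | D'.+1 => fun l => (l.1, 0, leafvar l.2)
  end.

Lemma leafvar_inj D : injective (@leafvar D).
Proof.
elim: D => [|D IH] /=; first by move=> i j [].
by move=> [i l] [i' l'] /= [-> /IH ->].
Qed.

(* Setting every variable other than [leafvar l] according to [isolate l] turns
   [P^(D)] into the variable [leafvar l]. *)
Fixpoint isolate (D : nat) : leaf D -> Xvar n.+1 D -> bool :=
  match D return leaf D -> Xvar n.+1 D -> bool with
  | 0 => fun l x => (x.1 == l) ||
      (((x.1 < 2)%N != (l < 2)%N) && (val x.1 \in [:: 0; 2]%N))
  | D'.+1 => fun l x => (x.1.2 == 0) &&
      (if x.1.1 == l.1 then isolate l.2 x.2
       else (x.2 == leafvar (leaf0 D')) || isolate (leaf0 D') x.2)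
  end.

Definition single D (s : status) (l : leaf D) (x : Xvar n.+1 D) : status :=
  if x == leafvar l then s else inl (isolate l x).

(** Bits, leaves and lower levels are drawn for every block, whether or not it survives, so the
    space is a plain product and averages over it factor. *)
Fixpoint omega (D : nat) (W : finType) : finType :=
  match D with
  | 0 => unit
  | D'.+1 => ({ffun W * 'I_n.+1 -> bool} * {ffun W * 'I_n.+1 -> leaf D'} *
              omega D' (W * 'I_n.+1)%type)%type
  end.

Lemma omega_inhabited D W : omega D W.
Proof.
elim: D W => [|D IH] W /=; first exact: tt.
by split; [split; apply: finfun => _; [exact: true|exact: leaf0] | exact: IH].
Qed.

(* The random restriction of a forest of copies of [P^(D)] indexed by [W]. In a
   copy [w], the factor [i] either keeps its first summand, restricted
   recursively, and loses its second one, or becomes [y + z] with [y] a random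
   leaf of the first summand and [z] a fixed leaf of the second one. *)
Fixpoint restr (D : nat) (W : finType) :
    omega D W -> W -> Xvar n.+1 D -> status :=
  match D return omega D W -> W -> Xvar n.+1 D -> status with
  | 0 => fun _ _ x =>
      if x.2 == 0 then inr (val x.1 \in [:: 0; 2]%N) else inl true
  | D'.+1 => fun o w x =>
      let wi := (w, x.1.1) in
      if x.1.2 == 0 then
        if o.1.1 wi then restr o.2 wi x.2
        else single (inr true) (o.1.2 wi) x.2
      else
        if o.1.1 wi then inl false else single (inr false) (leaf0 D') x.2
  end.

(** Meaningful on live row variables only: sends [y] to the [z] of its factor [y + z]. *)
Fixpoint partner (D : nat) (W : finType) :
    omega D W -> W -> Xvar n.+1 D -> Xvar n.+1 D :=
  match D return omega D W -> W -> Xvar n.+1 D -> Xvar n.+1 D with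
  | 0 => fun _ _ x => (inord x.1.+1, x.2)
  | D'.+1 => fun o w x =>
      let wi := (w, x.1.1) in
      if o.1.1 wi then (x.1, partner o.2 wi x.2)
      else (x.1.1, 1, leafvar (leaf0 D'))
  end.

Lemma restr_partner D W (o : omega D W) w x :
  restr o w x = inr true -> restr o w (partner o w x) = inr false.
Proof.
elim: D W o w x => [|D IH] W o w /=.
  move=> [i j] /=; case: eqP => // _ [].
  by rewrite !inE => /orP[] /eqP ->; rewrite inordK.
move=> [[i j] y] /=; case: ifP => [j0|_].
  case: ifP => b /=; first by rewrite j0 b; exact: IH.
  by move=> _; rewrite b /single eqxx.
by case: ifP => // _; rewrite /single; case: ifP.
Qed.

Lemma partner_inj D W (o : omega D W) w x y :
  restr o w x = inr true -> restr o w y = inr true ->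
  partner o w x = partner o w y -> x = y.
Proof.
elim: D W o w x y => [|D IH] W o w /=.
  move=> [i j] [i' j'] /=; case: (altP (j =P 0)) => [->|//] [iE].
  case: (altP (j' =P 0)) => [->|//] [iE'] [].
  have lt4 (k : 'I_4) : [|| k == 0 :> nat, k == 2 :> nat | false] -> (k.+1 < 4)%N.
    by rewrite orbF => /orP[] /eqP ->.
  move=> /(congr1 val); rewrite /= !inordK ?lt4 //.
  by move=> [] ii; congr (_, _); apply: val_inj.
move=> [[i j] x] [[i' j'] y] /=.
case: (altP (j =P 0)) => [->|_]; last by case: ifP => // _; rewrite /single; case: ifP.
case: (altP (j' =P 0)) => [->|_] h; last by case: ifP => // _; rewrite /single; case: ifP.
move: h; have [b|b] := boolP (o.1.1 (w, i)); have [b'|b'] := boolP (o.1.1 (w, i')).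
- move=> hx hy [ii' xy]; subst i'; congr (_, _).
  exact: (IH _ _ _ _ _ hx hy xy).
- by move=> _ _ [ii']; move: b b'; rewrite ii' => ->.
- by move=> _ _ [ii']; move: b b'; rewrite ii' => /negPf ->.
- move=> hx hy [ii']; subst i'; move: hx hy; rewrite /single.
  by case: eqP => [-> _|//]; case: eqP => [->|].
Qed.

Lemma big_ord2 (T : Type) (idx : T) (op : Monoid.law idx) (f : 'I_2 -> T) :
  \big[op/idx]_j f j = op (f 0) (f 1).
Proof.
rewrite !big_ord_recl big_ord0 Monoid.mulm1; congr (op (f _) (f _)).
all: exact: val_inj.
Qed.

Lemma big_Xvar (T : Type) (idx : T) (op : Monoid.com_law idx) D
    (f : Xvar n.+1 D.+1 -> T) :
  \big[op/idx]_x f x =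
  \big[op/idx]_i op (\big[op/idx]_y f (i, 0, y)) (\big[op/idx]_y f (i, 1, y)).
Proof.
transitivity (\big[op/idx]_(ij : 'I_n.+1 * 'I_2)
    \big[op/idx]_(y : Xvar n.+1 D) f (ij, y)).
  by rewrite pair_bigA /=; apply: (@eq_bigr _ _ _ ('I_n.+1 * 'I_2 * Xvar n.+1 D)%type) => -[].
transitivity (\big[op/idx]_(i < n.+1) \big[op/idx]_(j < 2)
    \big[op/idx]_(y : Xvar n.+1 D) f (i, j, y)).
  by rewrite [RHS]pair_bigA; apply: eq_bigr => -[].
by apply: eq_bigr => i _; rewrite big_ord2.
Qed.

Lemma big_Xvar0 (T : Type) (idx : T) (op : Monoid.com_law idx)
    (f : Xvar n.+1 0 -> T) :
  \big[op/idx]_x f x = \big[op/idx]_(i < 4) op (f (i, 0)) (f (i, 1)).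
Proof.
transitivity (\big[op/idx]_(i < 4) \big[op/idx]_(j < 2) f (i, j)).
  by rewrite pair_bigA; apply: (@eq_bigr _ _ _ ('I_4 * 'I_2)%type) => -[].
by apply: eq_bigr => i _; rewrite big_ord2.
Qed.

Lemma single_live D s t (l : leaf D) y :
  (single (inr s) l y == inr t) = (s == t) && (y == leafvar l).
Proof. by rewrite /single; case: (y == leafvar l); rewrite ?andbT ?andbF. Qed.

Lemma sum_single D s t (l : leaf D) :
  (\sum_y (single (inr s) l y == inr t))%N = (s == t).
Proof.
under eq_bigr => y _ do rewrite single_live.
case: (s == t) => /=; last by rewrite big1.
by rewrite (bigD1 (leafvar l)) //= eqxx big1 // => y /negPf ->.
Qed.

(** Each factor [y + z] has one variable on each side. With this balance, full rank means relative
    rank 1. *)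
Lemma restr_balanced D W (o : omega D W) w :
  side (restr o w) xpredT true = side (restr o w) xpredT false.
Proof.
elim: D W o w => [|D IH] W o w.
  by rewrite /side !big_Xvar0 !big_ord_recl !big_ord0.
rewrite /side !(@big_Xvar _ _ _ D); apply: eq_bigr => i _ /=.
case: (o.1.1 (w, i)) => /=; last by rewrite !sum_single.
by rewrite !sum_nat_const !muln0; congr addn; exact: IH.
Qed.

(** * Values of the restricted polynomial *)

Section Values.
Variable F : fieldType.

(** The values of [Ppoly], by a recursion free of formal polynomials; [Ppoly_eval] makes the
    link. *)
Fixpoint Pval (D : nat) : (Xvar n.+1 D -> F) -> F :=
  match D return (Xvar n.+1 D -> F) -> F with
  | 0 => fun v => \sum_(i1 < 4 | (i1 < 2)%N) \sum_(i2 < 4 | (2 <= i2)%N)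
      v (i1, 0) * v (i1, 1) * v (i2, 0) * v (i2, 1)
  | D'.+1 => fun v => \prod_(i < n.+1)
      (Pval (fun y => v (i, 0, y)) + Pval (fun y => v (i, 1, y)))
  end.

Lemma eq_Pval D (v v' : Xvar n.+1 D -> F) : v =1 v' -> Pval v = Pval v'.
Proof.
elim: D v v' => [|D IH] v v' vv'.
  by apply: eq_bigr => i _; apply: eq_bigr => j _; rewrite !vv'.
by apply: eq_bigr => i _; congr (_ + _); apply: IH => y; apply: vv'.
Qed.

Lemma Pval0E (v : Xvar n.+1 0 -> F) : Pval v =
  (v (inord 0, 0) * v (inord 0, 1) + v (inord 1, 0) * v (inord 1, 1)) *
  (v (inord 2, 0) * v (inord 2, 1) + v (inord 3, 0) * v (inord 3, 1)).
Proof.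
have ord4 (f : 'I_4 -> F) (P : pred nat) : \sum_(i < 4 | P i) f i =
    (if P 0%N then f (inord 0) else 0) + (if P 1%N then f (inord 1) else 0) +
    (if P 2%N then f (inord 2) else 0) + (if P 3%N then f (inord 3) else 0).
  rewrite big_mkcond !big_ord_recl big_ord0 /= addr0 !addrA.
  by congr (_ + _ + _ + _); case: ifP => // _; congr f; apply: val_inj;
    rewrite /= inordK.
rewrite /= (ord4 _ (fun i => (i < 2)%N)) /= !(ord4 _ (fun i => (2 <= i)%N)) /=.
ring.
Qed.

Lemma Pval_zero D (v : Xvar n.+1 D -> F) : (forall x, v x = 0) -> Pval v = 0.
Proof.
elim: D v => [|D IH] v v0.
  by rewrite Pval0E !v0 !mulr0 addr0 mul0r.
by rewrite /= big_ord_recl !IH ?addr0 ?mul0r.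
Qed.

(** In [P0], the companion of the leaf and one pair of the opposite factor are 1, the rest 0. Higher
    up, second summands vanish, and a factor off the path evaluates to its isolated variable, itself
    set to 1. *)
Lemma Pval_isolate D (l : leaf D) (v : Xvar n.+1 D -> F) :
  (forall x, x != leafvar l -> v x = (isolate l x)%:R) -> Pval v = v (leafvar l).
Proof.
elim: D l v => [|D IH] l v vE.
  rewrite Pval0E.
  have v1 (i : 'I_4) : v (i, 1) = (isolate (l : leaf 0) (i, 1))%:R.
    by apply: vE; rewrite xpair_eqE andbF.
  have v0 (i : 'I_4) : v (i, 0) =
      if i == l then v (l, 0) else (isolate (l : leaf 0) (i, 0))%:R.
    case: eqP => [->//|/eqP il]; apply: vE.
    by rewrite xpair_eqE (negPf il).
  rewrite -[v (leafvar l)]/(v (l, 0)).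
  move: v0; set w := v (l, 0); clearbody w => v0.
  rewrite !v1 !v0 /= -!val_eqE /= !inordK //.
  by case: l {v0 v1 vE} => -[|[|[|[|//]]]] i /=; rewrite ?mulr1n ?mulr0n; ring.
case: l vE => i0 l vE /=; rewrite (bigD1 i0) //= big1 ?mulr1; last first.
  move=> i ii0.
  rewrite (IH (leaf0 D)); last first.
    move=> y yl; rewrite vE /= ?eqxx ?(negPf ii0) ?(negPf yl) //.
    by rewrite !xpair_eqE (negPf ii0).
  rewrite vE /= ?eqxx ?(negPf ii0) //; last by rewrite !xpair_eqE (negPf ii0).
  rewrite Pval_zero ?addr0 // => y.
  by rewrite vE // !xpair_eqE andbF.
rewrite (IH l); last first.
  move=> y yl; rewrite vE /= ?eqxx //.
  by rewrite !xpair_eqE (negPf yl) andbF.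
rewrite Pval_zero ?addr0 // => y.
by rewrite vE // !xpair_eqE andbF.
Qed.

Lemma Pval_single D s (l : leaf D) (v : Xvar n.+1 D -> F) :
  (forall x c, single (inr s) l x = inl c -> v x = c%:R) -> Pval v = v (leafvar l).
Proof.
by move=> vE; apply: Pval_isolate => x xl; apply: vE; rewrite /single (negPf xl).
Qed.

Lemma prod_single D s (l : leaf D) (g : Xvar n.+1 D -> F) :
  \prod_(y | single (inr s) l y == inr true) g y =
  if s then g (leafvar l) else 1.
Proof.
under eq_bigl => y do rewrite single_live.
by case: s => /=; [rewrite big_pred1_eq | rewrite big_pred0].
Qed.

(** Where the bit is true the second summand vanishes and the first is handled recursively;
    elsewhere both summands collapse to single variables. *)
Lemma Pval_restr D W (o : omega D W) w (v : Xvar n.+1 D -> F) :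
  (forall x c, restr o w x = inl c -> v x = c%:R) ->
  Pval v = \prod_(x | restr o w x == inr true) (v x + v (partner o w x)).
Proof.
elim: D W o w v => [|D IH] W o w v vE.
  rewrite Pval0E !(vE (_, 1) true) // !mulr1.
  rewrite big_mkcond big_Xvar0 /= !big_ord_recl !big_ord0 /= !mulr1 !mul1r.
  by congr ((v (_, _) + v (_, _)) * (v (_, _) + v (_, _))); apply: val_inj;
    rewrite /= ?inordK.
rewrite big_mkcond (@big_Xvar _ _ _ D) /=; apply: eq_bigr => i _.
rewrite -!big_mkcond /=; case: (boolP (o.1.1 (w, i))) => b.
  rewrite [X in _ * X]big_pred0_eq mulr1 [X in _ + X]Pval_zero ?addr0.
    by apply: IH => x c h; apply: vE; rewrite /= b.
  by move=> y; rewrite (vE _ false) //= b.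
rewrite !prod_single mulr1.
rewrite (@Pval_single _ true (o.1.2 (w, i))); last first.
  by move=> x c h; apply: vE; rewrite /= (negPf b).
rewrite (@Pval_single _ false (leaf0 D)) // => x c h.
by apply: vE; rewrite /= (negPf b).
Qed.

End Values.

End Restriction.

(** * From circuits to levels *)

Module Circuits.

Import mpoly.

(** * Degree in a single variable *)

Section VariableDegree.
Variables (F : fieldType) (N : nat) (x : 'I_N).
Implicit Types p : {mpoly F[N]}.

Definition occurs p := has (fun m : 'X_{1..N} => (0 < m x)%N) (msupp p).

Let C : {rmorphism F -> {poly {mpoly F[N]}}} := polyC \o @mpolyC N F.
Let h (k : 'I_N) : {poly {mpoly F[N]}} := ('X_k)%:P * (if k == x then 'X else 1).

(* [p] as a univariate polynomial in [x]; the coefficients keep the power of [x]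
   so that they are easy to read off. *)
Definition in_var p : {poly {mpoly F[N]}} := mmap C h p.

Lemma coef_in_var p j :
  (in_var p)`_j = \sum_(m <- msupp p | m x == j) p@_m *: 'X_[m].
Proof.
rewrite /in_var /mmap coef_sum [RHS]big_mkcond; apply: eq_bigr => m _ /=.
have -> : mmap1 h m = ('X_[m])%:P * 'X^(m x).
  rewrite /mmap1 /h; under eq_bigr => k _ do rewrite exprMn.
  rewrite big_split /=; congr (_ * _).
    rewrite mpolyXE_id rmorph_prod /=; apply: eq_bigr => k _.
    by rewrite rmorphXn.
  rewrite (bigD1 x) //= eqxx big1 ?mulr1 // => k /negPf ->.
  by rewrite expr1n.
rewrite mulrA -polyCM coefCM coefXn eq_sym.
case: eqP => _; last by rewrite mulr0.
by rewrite mulr1 mul_mpolyC.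
Qed.

Lemma size_in_var p m : m \in msupp p -> (m x < size (in_var p))%N.
Proof.
move=> pm; rewrite ltnNge; apply/negP => /(nth_default 0).
rewrite coef_in_var => /(congr1 (mcoeff m)); rewrite mcoeff0 raddf_sum /=.
rewrite big_mkcond (bigD1_seq m) ?msupp_uniq //= eqxx.
rewrite mcoeffZ mcoeffX eqxx mulr1 big1 ?addr0.
  by move/eqP; rewrite mcoeff_eq0 pm.
by move=> k /negPf km; case: ifP => // _; rewrite mcoeffZ mcoeffX km mulr0.
Qed.

Lemma size_in_var_multilinear p : multilinear p -> (size (in_var p) <= 2)%N.
Proof.
move=> ml; apply/leq_sizeP => j j2; rewrite coef_in_var big_seq_cond big1 // => m.
by move=> /andP[/(ml m x) mx /eqP mj]; move: mx; rewrite mj leqNgt j2.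
Qed.

Lemma in_var_neq0 p : p != 0 -> in_var p != 0.
Proof.
rewrite -msupp_eq0; case E: (msupp p) => [//|m s] _.
have := @size_in_var p m; rewrite E inE eqxx => /(_ isT).
by rewrite -size_poly_gt0; apply: leq_trans.
Qed.

Lemma occurs_size p : occurs p -> (1 < size (in_var p))%N.
Proof. by move=> /hasP[m pm mx]; apply: leq_trans (size_in_var pm). Qed.

(** Meant for [z] the sizes, that is degrees plus one, of nonzero polynomials: their product has
    size the sum plus one minus [n], here at least 3. *)
Lemma sum_gt_card n (z : 'I_n -> nat) k l : k != l ->
  (forall i, 0 < z i)%N -> (1 < z k)%N -> (1 < z l)%N -> (n.+1 < \sum_i z i)%N.
Proof.
move=> kl z0 zk zl; rewrite (bigD1 k) //= (bigD1 l) //=; last by rewrite eq_sym.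
have : (\sum_(i < n | (i != k) && (i != l)) 1 <=
        \sum_(i < n | (i != k) && (i != l)) z i)%N by apply: leq_sum.
have : (\sum_(i < n) 1 = n)%N by rewrite sum1_card card_ord.
rewrite (bigD1 k) //= (bigD1 l) /=; [|by rewrite eq_sym].
move: (\sum_(i < n | _) 1)%N (\sum_(i < n | _) z i)%N => u t; lia.
Qed.

(** Degrees in [x] add over nonzero factors, so two factors containing [x] would give degree at
    least 2. Multilinearity thus makes the factors variable-disjoint. *)
Lemma occurs_prod n (q : 'I_n -> {mpoly F[N]}) k l :
  \prod_i q i != 0 -> multilinear (\prod_i q i) ->
  occurs (q k) -> occurs (q l) -> k = l.
Proof.
move=> q0 ml /occurs_size kx /occurs_size lx; apply/eqP/negPn/negP => kl.
have qi i : in_var (q i) != 0.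
  by apply: in_var_neq0; move/prodf_neq0: q0 => /(_ i isT).
have := size_in_var_multilinear ml; rewrite /in_var rmorph_prod /= -/in_var.
rewrite size_prod; last by move=> i _; apply: qi.
have {qi} z0 i : (0 < size (in_var (q i)))%N by rewrite size_poly_gt0.
have := sum_gt_card kl z0 kx lx; rewrite card_ord.
rewrite /in_var; set t := (\sum_(i < n) _)%N.
by move=> nt; rewrite leqNgt => /negP; apply; rewrite subSn; [lia|exact: ltnW (ltnW nt)].
Qed.

End VariableDegree.

(** * Polynomials evaluated on a class of variables *)

Section Evaluation.
Variables (F : fieldType) (N : nat).
Implicit Types (S : pred 'I_N) (p : {mpoly F[N]}).

(** Zeroing the variables outside [S] makes the function depend on [S] only, as each factor of a
    [level] must. *)
Definition ev S p (b : bpoint 'I_N) : F := p.@[fun k => (S k && b k)%:R].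

Lemma ev_occurs S S' p b :
  (forall x, occurs x p -> S x = S' x) -> ev S p b = ev S' p b.
Proof.
move=> SS'; rewrite /ev !mevalE big_seq [RHS]big_seq; apply: eq_bigr => m pm.
congr (_ * _); apply: eq_bigr => x _.
have [->|mx] := posnP (m x); first by rewrite !expr0.
by rewrite SS' //; apply/hasP; exists m.
Qed.

(** Pads an input to any depth: one term of coefficient 1, the others of coefficient 0, and a
    partition with a single class. *)
Lemma affine_level s d S (phi : bpoint 'I_N -> F) :
  (0 < s)%N -> affine_on S phi -> level s d S phi.
Proof.
move=> s0; elim: d S phi => [//|d IH] S phi aff.
exists (fun j => (j == Ordinal s0)%:R), (fun=> 1%N), (fun _ _ => 0), (fun _ _ => phi).
split=> [p|j k].
  rewrite (bigD1 (Ordinal s0)) // eqxx big_ord1 mul1r big1 /= ?addr0 // => j /negPf ->.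
  by rewrite mul0r.
apply: IH; case: aff => c [l phiE]; exists c, l => p; rewrite phiE; congr (_ + _).
by apply: eq_bigl => x; rewrite (ord1 k) eqxx andbT.
Qed.

Lemma affine_const S (c : F) : affine_on S (fun _ : bpoint 'I_N => c).
Proof.
by exists c, (fun=> 0) => p; rewrite big1 ?addr0 // => x _; rewrite mul0r.
Qed.

(** Sums will range over all gates of a circuit, so affinity is asked only where the coefficient is
    nonzero. *)
Lemma affine_sum S (I : finType) (c : I -> F) (phi : I -> bpoint 'I_N -> F) :
  (forall i, c i != 0 -> affine_on S (phi i)) ->
  affine_on S (fun b => \sum_i c i * phi i b).
Proof.
move=> aff.
have {}aff i : exists dl : F * ('I_N -> F), c i != 0 ->
    forall b, phi i b = dl.1 + \sum_(x | S x) dl.2 x * (b x)%:R.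
  have [ci|ci] := eqVneq (c i) 0; first by exists (0, fun=> 0).
  by have [d [l E]] := aff i ci; exists (d, l).
have [dl E] := fin_all_exists aff.
exists (\sum_i c i * (dl i).1), (fun x => \sum_i c i * (dl i).2 x) => p.
under [X in _ + X]eq_bigr => x _ do rewrite mulr_suml.
rewrite exchange_big -big_split /=; apply: eq_bigr => i _.
have [->|ci] := eqVneq (c i) 0.
  by rewrite !mul0r add0r big1 // => x _; rewrite !mul0r.
rewrite E // mulrDr mulr_sumr; congr (_ + _).
by apply: eq_bigr => x _; rewrite mulrA.
Qed.

(** By [occurs_prod] a variable can be coloured by the one factor containing it (0 by default);
    zeroing the other classes does not change that factor. *)
Lemma ev_prod_level s d S n (q : 'I_n.+1 -> {mpoly F[N]}) :
  \prod_i q i != 0 -> multilinear (\prod_i q i) ->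
  (forall i S', level s d S' (ev S' (q i))) ->
  exists (col : 'I_N -> 'I_n.+1) (psi : 'I_n.+1 -> bpoint 'I_N -> F),
    (forall b, ev S (\prod_i q i) b = \prod_i psi i b) /\
    (forall i, level s d (fun x => S x && (col x == i)) (psi i)).
Proof.
move=> q0 ml lev; pose col x := odflt 0 [pick i | occurs x (q i)].
exists col, (fun i => ev (fun x => S x && (col x == i)) (q i)); split=> [b|i].
  rewrite {1}/ev rmorph_prod /=; apply: eq_bigr => i _.
  apply: ev_occurs => x xi; rewrite /col; case: pickP => [j xj|/(_ i)]; last by rewrite xi.
  by rewrite /= (occurs_prod q0 ml xj xi) eqxx andbT.
exact: lev.
Qed.

End Evaluation.

(** * Product-depth and expansion of gates *)

Section Gates.
Variables (F : fieldType) (N : nat).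
Implicit Types (gs : seq (gate F N)) (C : circuit F N).

Let polys gs := foldl (fun vs g => rcons vs (gate_poly vs g)) [::] gs.

Lemma polys_rcons gs g :
  polys (rcons gs g) = rcons (polys gs) (gate_poly (polys gs) g).
Proof. by rewrite /polys foldl_rcons. Qed.

Lemma size_polys gs : size (polys gs) = size gs.
Proof.
by elim/last_ind: gs => [//|gs g IH]; rewrite polys_rcons !size_rcons IH.
Qed.

Lemma nth_polys gs i : (i < size gs)%N ->
  (polys gs)`_i = gate_poly (take i (polys gs)) (nth (GConst N 0) gs i).
Proof.
elim/last_ind: gs => [//|gs g IH]; rewrite size_rcons ltnS leq_eqVlt.
rewrite polys_rcons !nth_rcons size_polys => /orP[/eqP ->|lti].
  by rewrite ltnn eqxx -cats1 take_size_cat // size_polys.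
by rewrite lti IH // -cats1 takel_cat // size_polys ltnW.
Qed.

Lemma gate_at_wf C i : (i < circuit_size C)%N ->
  (forall j, j \in children (gate_at C i) -> (j < i)%N) /\
  (is_input (gate_at C i) \/ children (gate_at C i) != [::]).
Proof.
move=> ilt; have /allP/(_ i) := gates_wf C.
rewrite mem_iota add0n ilt => /(_ isT) /andP[/allP ch inp].
by split=> //; case/orP: inp; [left | right].
Qed.

Lemma size_circuit_polys C : size (circuit_polys C) = circuit_size C.
Proof. exact: size_polys. Qed.

Lemma nth_circuit_polys C i : (i < circuit_size C)%N ->
  (circuit_polys C)`_i = gate_poly (circuit_polys C) (gate_at C i).
Proof.
move=> ilt; rewrite nth_polys // -/(gate_at C i).
have [ch _] := gate_at_wf ilt; case: (gate_at C i) ch => //= s ch.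
  rewrite big_seq [RHS]big_seq; apply: eq_bigr => e es; rewrite nth_take //.
  by apply: ch; apply: map_f.
by rewrite big_seq [RHS]big_seq; apply: eq_bigr => e es; rewrite nth_take ?ch.
Qed.

Definition depth_le C i d := forall i0 s,
  is_input (gate_at C i0) -> path (wire C) i0 s -> last i0 s = i ->
  (count (fun j => is_prod (gate_at C j)) (i0 :: s) <= d)%N.

Lemma depth_step C i j d : wire C j i -> depth_le C i d ->
  depth_le C j (d - is_prod (gate_at C i)).
Proof.
move=> ji di i0 s inp pth lst.
have := di i0 (rcons s i) inp; rewrite rcons_path pth lst ji last_rcons.
by move=> /(_ isT erefl); rewrite -rcons_cons -cats1 count_cat /=; lia.
Qed.

(** Descending through first children reaches an input, so some path ends at gate [i] and counts
    it. *)
Lemma depth_prod C i d : (i < circuit_size C)%N -> depth_le C i d ->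
  is_prod (gate_at C i) -> (0 < d)%N.
Proof.
move=> ilt di ip.
have [i0 [s [inp pth lst]]] : exists i0 s,
    [/\ is_input (gate_at C i0), path (wire C) i0 s & last i0 s = i].
  elim/ltn_ind: i ilt {di ip} => i IH ilt.
  have [ch [inp|]] := gate_at_wf ilt; first by exists i, [::].
  case E: (children (gate_at C i)) ch => [//|j t] ch _.
  have ji : (j < i)%N by apply: ch; rewrite inE eqxx.
  have [i0 [s [inp pth lst]]] := IH j ji (ltn_trans ji ilt).
  exists i0, (rcons s i); split; rewrite ?last_rcons // rcons_path pth lst.
  by rewrite /wire E inE eqxx.
have := di _ _ inp pth lst; apply: leq_trans; rewrite -has_count.
apply/hasP; exists i => //; rewrite -lst; exact: mem_last.
Qed.

(** Nested sum gates collapse at no cost in product-depth. Indexing the terms by gates bounds their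
    number by the circuit size, however many wires there are. *)
Lemma sum_gate_expand C i d : (i < circuit_size C)%N -> depth_le C i d ->
  exists c : 'I_(circuit_size C) -> F,
    (circuit_polys C)`_i = \sum_h c h *: (circuit_polys C)`_h /\
    forall h : 'I_(circuit_size C), c h != 0 -> [/\ (h <= i)%N, depth_le C h d &
      is_input (gate_at C h) \/ is_prod (gate_at C h)].
Proof.
elim/ltn_ind: i => i IH ilt di.
have single : is_input (gate_at C i) \/ is_prod (gate_at C i) ->
    exists c : 'I_(circuit_size C) -> F,
    (circuit_polys C)`_i = \sum_h c h *: (circuit_polys C)`_h /\
    forall h : 'I_(circuit_size C), c h != 0 -> [/\ (h <= i)%N, depth_le C h d &
      is_input (gate_at C h) \/ is_prod (gate_at C h)].
  move=> ip; exists (fun h => (h == Ordinal ilt)%:R); split.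
    rewrite (bigD1 (Ordinal ilt)) //= eqxx scale1r big1 ?addr0 // => h /negPf ->.
    by rewrite scale0r.
  by move=> h; have [->//|/negPf hi] := eqVneq h (Ordinal ilt); rewrite /= ?hi ?eqxx.
case E: (gate_at C i) => [k|a|t|t]; try by apply: single; rewrite E; auto.
have [ch _] := gate_at_wf ilt; rewrite nth_circuit_polys // E /=.
have : forall e, e \in t -> (e.2 < i)%N /\ depth_le C e.2 d.
  move=> e et; have ei : e.2 \in children (gate_at C i).
    by rewrite E /=; apply: map_f.
  split; first exact: ch.
  by have := depth_step ei di; rewrite E subn0.
elim: t {E} => [|e t IHt] et.
  exists (fun=> 0); split; last by move=> h; rewrite eqxx.
  by rewrite big_nil big1 // => h _; rewrite scale0r.
have [c [cE cP]] : exists c : 'I_(circuit_size C) -> F,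
    \sum_(e <- t) e.1 *: (circuit_polys C)`_(e.2) =
      \sum_h c h *: (circuit_polys C)`_h /\
    forall h : 'I_(circuit_size C), c h != 0 -> [/\ (h <= i)%N, depth_le C h d &
      is_input (gate_at C h) \/ is_prod (gate_at C h)].
  by apply: IHt => f ft; apply: et; rewrite inE ft orbT.
have [ei ed] : (e.2 < i)%N /\ depth_le C e.2 d by apply: et; rewrite inE eqxx.
have [c' [cE' cP']] := IH _ ei (ltn_trans ei ilt) ed.
exists (fun h => e.1 * c' h + c h); split.
  rewrite big_cons cE cE' scaler_sumr -big_split; apply: eq_bigr => h _ /=.
  by rewrite scalerDl scalerA.
move=> h; have [->|ch0 _] := eqVneq (c h) 0; last exact: cP.
have [->|ch0 _] := eqVneq (c' h) 0; first by rewrite mulr0 addr0 eqxx.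
by have [hi hd hp] := cP' h ch0; split=> //; apply: leq_trans hi (ltnW ei).
Qed.

Lemma input_affine C i S : (i < circuit_size C)%N -> is_input (gate_at C i) ->
  affine_on S (ev S (circuit_polys C)`_i).
Proof.
move=> ilt; rewrite nth_circuit_polys //.
case: (gate_at C i) => //= [k|a] _; last first.
  have [c [l E]] := affine_const S a; exists c, l => p.
  by rewrite /ev mevalC -(E p).
exists 0, (fun x => (x == k)%:R) => p; rewrite /ev mevalXU add0r.
have [Sk|Sk] := boolP (S k).
  by rewrite (bigD1 k) //= eqxx mul1r big1 ?addr0 // => x /andP[_ /negPf ->]; rewrite mul0r.
by rewrite big1 // => x Sx; case: eqP => [xk|]; rewrite ?mul0r //; rewrite xk (negPf Sk) in Sx.
Qed.

(** After [sum_gate_expand] only inputs and product gates remain: at depth 0 just inputs, and above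
    it each product gate uses up one level through [ev_prod_level]. *)
Lemma gate_level C i d S : multilinear_circuit C -> (i < circuit_size C)%N ->
  depth_le C i d -> level (circuit_size C) d S (ev S (circuit_polys C)`_i).
Proof.
move=> ml; elim/ltn_ind: i d S => i IH d S ilt di.
have s0 : (0 < circuit_size C)%N by apply: leq_ltn_trans ilt.
have [c [cE cP]] := sum_gate_expand ilt di.
have evE b : ev S (circuit_polys C)`_i b =
    \sum_h c h * ev S (circuit_polys C)`_h b.
  by rewrite /ev cE raddf_sum; apply: eq_bigr => h _; rewrite /= mevalZ.
case: d di cP => [|d] di cP.
  have [e [l E]] : affine_on S (fun b =>
      \sum_(h < circuit_size C) c h * ev S (circuit_polys C)`_h b).
    apply: affine_sum => h /cP[_ dh [inp|pr]]; first exact: input_affine.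
    by have := depth_prod (ltn_ord h) dh pr.
  by exists e, l => b; rewrite evE E.
have term (h : 'I_(circuit_size C)) : exists (r : F) (n : nat) (col : 'I_N -> 'I_n)
    (psi : 'I_n -> bpoint 'I_N -> F),
    (forall b, c h * ev S (circuit_polys C)`_h b = r * \prod_k psi k b) /\
    (forall k, level (circuit_size C) d (fun x => S x && (col x == k)) (psi k)).
  have triv r (psi : bpoint 'I_N -> F) : affine_on S psi ->
      (forall b, c h * ev S (circuit_polys C)`_h b = r * psi b) ->
      exists (r : F) (n : nat) (col : 'I_N -> 'I_n) (psi : 'I_n -> bpoint 'I_N -> F),
    (forall b, c h * ev S (circuit_polys C)`_h b = r * \prod_k psi k b) /\
    (forall k, level (circuit_size C) d (fun x => S x && (col x == k)) (psi k)).
    move=> [e [l aff]] E; exists r, 1%N, (fun=> 0), (fun=> psi); split=> [b|k].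
      by rewrite E big_ord1.
    apply: affine_level => //; exists e, l => b; rewrite aff; congr (_ + _).
    by apply: eq_bigl => x; rewrite (ord1 k) eqxx andbT.
  have [ch|ch] := eqVneq (c h) 0.
    by apply: (triv 0 (fun=> 0)); [exact: affine_const|move=> b; rewrite ch !mul0r].
  (* A zero product says nothing about the variables of its factors, so it is replaced by a constant
     term. *)
  have [p0|p0] := eqVneq (circuit_polys C)`_h 0.
    apply: (triv 0 (fun=> 0)); first exact: affine_const.
    by move=> b; rewrite p0 /ev meval0 mulr0 mul0r.
  have [hi dh [inp|pr]] := cP h ch.
    by apply: (triv (c h) (ev S (circuit_polys C)`_h)); [exact: input_affine|].
  have [chi [|chn]] := gate_at_wf (ltn_ord h); first by case: (gate_at C h) pr.
  have mlh : multilinear (circuit_polys C)`_h.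
    by apply: ml; apply: mem_nth; rewrite size_circuit_polys.
  have stepd j : j \in children (gate_at C h) -> depth_le C j d.
    by move=> jh; have := depth_step jh dh; rewrite pr subn1.
  move: p0 mlh; rewrite nth_circuit_polys //.
  case: (gate_at C h) pr chi chn stepd => //= t _ chi tn stepd.
  case: t tn chi stepd => [//|j0 t] _ chi stepd.
  rewrite (big_nth 0%N) big_mkord => p0 mlh.
  have [|col [psi [E L]]] := @ev_prod_level _ _ (circuit_size C) d S _ _ p0 mlh.
    move=> k S'; have kt : nth 0%N (j0 :: t) k \in j0 :: t by apply: mem_nth.
    apply: IH (stepd _ kt); first exact: leq_trans (chi _ kt) hi.
    exact: ltn_trans (chi _ kt) (ltn_ord h).
  by exists (c h), (size t).+1, col, psi; split=> // b; rewrite E.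
have [r /fin_all_exists[n /fin_all_exists[col /fin_all_exists[psi H]]]] := fin_all_exists term.
exists r, n, col, psi; split=> [b|j k]; last by case: (H j).
by rewrite evE; apply: eq_bigr => h _; case: (H h).
Qed.

Lemma circuit_level C d : multilinear_circuit C -> product_depth_le C d ->
  level (circuit_size C) d xpredT
    (fun b => meval (fun k => (b k)%:R) (circuit_polys C)`_(output C)).
Proof. by move=> ml pd; apply: (gate_level xpredT ml (output_lt C) pd). Qed.

End Gates.

Lemma Ppoly_eval (F : fieldType) n D (v : 'I_#|Xvar n.+1 D| -> F) :
  (Ppoly F n.+1 D).@[v] = Pval (fun x => v (enum_rank x)).
Proof.
elim: D v => [|D IH] v.
  rewrite /= /P0 raddf_sum; apply: eq_bigr => i _; rewrite raddf_sum.
  by apply: eq_bigr => j _; rewrite /= !mevalM !mevalXU.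
rewrite /= rmorph_prod; apply: eq_bigr => i _ /=.
rewrite mevalD /copy_poly !comp_mpoly_meval !IH.
by congr GRing.add; apply: eq_Pval => x; rewrite tnth_mktuple enum_rankK mevalXU.
Qed.

End Circuits.

From mathcomp Require Import all_classical all_reals all_analysis.

Import numFieldNormedType.Exports.

(** * Averages over finite types *)

Section Average.
Variable R : realType.

Definition avg (T : finType) (f : T -> R) : R :=
  (#|T|%:R)^-1 * \sum_t f t.

Lemma eq_avg (T : finType) (f g : T -> R) : f =1 g -> avg f = avg g.
Proof. by move=> fg; congr (_ * _); apply: eq_bigr => t _; apply: fg. Qed.

Lemma avg_const (T : finType) (t0 : T) (c : R) : avg (fun _ : T => c) = c.
Proof.
rewrite /avg sumr_const -[c *+ _]mulr_natl mulrA mulVf ?mul1r //.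
by rewrite pnatr_eq0 -lt0n; apply/card_gt0P; exists t0.
Qed.

Lemma le_avg (T : finType) (f g : T -> R) :
  (forall t, f t <= g t) -> avg f <= avg g.
Proof.
move=> fg; apply: ler_wpM2l; first by rewrite invr_ge0 ler0n.
by apply: ler_sum => t _; apply: fg.
Qed.

Lemma avg_le (T : finType) (t0 : T) (f : T -> R) c :
  (forall t, f t <= c) -> avg f <= c.
Proof. by move=> fc; rewrite -(avg_const t0 c); apply: le_avg. Qed.

Lemma avg_ge0 (T : finType) (f : T -> R) : (forall t, 0 <= f t) -> 0 <= avg f.
Proof.
move=> f0; apply: mulr_ge0; first by rewrite invr_ge0 ler0n.
by apply: sumr_ge0 => t _; apply: f0.
Qed.

Lemma avgD (T : finType) (f g : T -> R) :
  avg (fun t => f t + g t) = avg f + avg g.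
Proof. by rewrite /avg big_split mulrDr. Qed.

Lemma avgZ (T : finType) c (f : T -> R) : avg (fun t => c * f t) = c * avg f.
Proof. by rewrite /avg -mulr_sumr mulrCA. Qed.

Lemma avg_sum (T I : finType) (P : pred I) (f : I -> T -> R) :
  avg (fun t => \sum_(i | P i) f i t) = \sum_(i | P i) avg (f i).
Proof. by rewrite /avg exchange_big -mulr_sumr. Qed.

Lemma avg_exchange (T1 T2 : finType) (f : T1 -> T2 -> R) :
  avg (fun s => avg (f s)) = avg (fun t => avg (f^~ t)).
Proof. by rewrite /avg -!mulr_sumr exchange_big /= mulrCA. Qed.

Lemma avg_pair (T1 T2 : finType) (f : T1 * T2 -> R) :
  avg f = avg (fun s => avg (fun t => f (s, t))).
Proof.
rewrite /avg -mulr_sumr mulrA -invfM -natrM -card_prod; congr (_ * _).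
by rewrite pair_bigA; apply: eq_bigr => -[].
Qed.

Lemma avg_prod (I T : finType) (g : I -> T -> R) :
  avg (fun f : {ffun I -> T} => \prod_i g i (f i)) = \prod_i avg (g i).
Proof.
rewrite /avg -bigA_distr_bigA /= card_ffun big_split /= prodr_const.
by rewrite natrX exprVn.
Qed.

End Average.

Section RealBounds.
Variable R : realType.

Lemma expRN_le (y : R) : 0 <= y <= 1 -> expR (- y) <= 1 - y / 2.
Proof.
move=> /andP[y0 y1]; rewrite expRN.
have e0 := expR_gt0 y.
rewrite -[leLHS]mul1r ler_pdivrMr //.
apply: (@le_trans _ _ ((1 - y / 2) * (1 + y))); first by nra.
by apply: ler_wpM2l; [lra | exact: expR_ge1Dx].
Qed.

Lemma le1_expRN (y : R) : 1 - y <= expR (- y).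
Proof. exact: expR_ge1Dx. Qed.

End RealBounds.

(** * Large cuts *)

Section MaxCut.
Variables (R : realType) (I K : finType) (A : pred I) (a : I -> K -> R).
Hypotheses (a_ge0 : forall w k, 0 <= a w k).
Hypothesis a_le1 : forall w, \sum_k a w k <= 1.

Definition load (w : I) (u : pred K) : R := \sum_k (u k)%:R * a w k.

Lemma load_ge0 w u : 0 <= load w u.
Proof. by apply: sumr_ge0 => k _; apply: mulr_ge0; rewrite ?ler0n. Qed.

Lemma load_le (u v : pred K) w : (forall k, u k -> v k) -> load w u <= load w v.
Proof.
move=> uv; apply: ler_sum => k _; apply: ler_wpM2r => //.
by rewrite ler_nat; case: (u k) (uv k) => // ->.
Qed.

Lemma load_le1 w u : load w u <= 1.
Proof.
apply: le_trans (a_le1 w); apply: ler_sum => k _.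
by case: (u k); rewrite ?mul1r ?mul0r.
Qed.

(* A maximal cut is locally optimal; summing over [k] the inequalities saying
   that moving [k] to the other side does not help gives the constant 1/4. *)
Lemma max_cut : exists u : pred K,
  (\sum_(w | A w) \sum_k a w k * (1 - a w k)) / 4
    <= \sum_(w | A w) load w u * (1 - load w u).
Proof.
pose Phi (u : {ffun K -> bool}) := \sum_(w | A w) load w u * (1 - load w u).
have [u _ umax] := @Order.TotalTheory.arg_maxP _ _ {ffun K -> bool}
  [ffun=> true] xpredT Phi isT.
exists u.
pose e k : R := 1 - 2 * (u k)%:R.
have e2 k : e k ^+ 2 = 1.
  by rewrite /e; case: (u k); rewrite ?mulr0 ?mulr1 ?subr0 ?expr1n //; lra.
have flip k : \sum_(w | A w) (e k * a w k * (1 - 2 * load w u) - a w k ^+ 2) <= 0.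
  pose v := [ffun l => u l (+) (l == k)].
  have lv w : load w v = load w u + e k * a w k.
    rewrite /load (bigD1 k) //= [in RHS](bigD1 k) //= ffunE eqxx.
    rewrite (@eq_bigr _ _ _ _ _ (fun l => l != k) _ (fun l => (u l)%:R * a w l)).
      by rewrite /e; case: (u k) => /=; ring.
    by move=> l /negPf lk; rewrite ffunE lk addbF.
  have : Phi v <= Phi u := umax v isT.
  rewrite -subr_le0; apply: le_trans; rewrite /Phi -sumrB.
  apply: ler_sum => w _; rewrite lv.
  have -> : a w k ^+ 2 = (e k * a w k) ^+ 2 by rewrite exprMn e2 mul1r.
  set x := load w u; set y := e k * a w k; lra.
have : \sum_k \sum_(w | A w) (e k * a w k * (1 - 2 * load w u) - a w k ^+ 2) <= 0.
  by rewrite -oppr_ge0 -sumrN sumr_ge0 // => k _; rewrite oppr_ge0.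
rewrite exchange_big /= => S0.
rewrite ler_pdivrMr // mulr_suml -subr_le0 -sumrB; apply: le_trans S0.
apply: ler_sum => w _.
set x := load w u.
have -> : \sum_k (e k * a w k * (1 - 2 * x) - a w k ^+ 2) =
    (\sum_k a w k - 2 * x) * (1 - 2 * x) - \sum_k a w k ^+ 2.
  rewrite sumrB -mulr_suml; congr (_ * _ - _).
  rewrite /x /load mulr_sumr -sumrB; apply: eq_bigr => k _.
  by rewrite /e mulrBl mul1r mulrA.
have -> : \sum_k a w k * (1 - a w k) = \sum_k a w k - \sum_k a w k ^+ 2.
  by rewrite -sumrB; apply: eq_bigr => k _; ring.
(* After cancellation the inequality is [b * x <= x], where [b] is the total share of the block. *)
have := load_ge0 w u; have := a_le1 w; rewrite -/x.
set b := \sum_k a w k; set c := \sum_k _; nra.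
Qed.

End MaxCut.

(** * Random parities *)

Section Parity.
Variables (R : realType) (I K L : finType) (A : pred I).
Variables (col : I -> L -> option K) (l0 : L) (kappa : R).
Hypothesis kappa_bnd : 0 <= kappa <= 3 / 4.

Definition hit (w : I) (k : K) : R := avg (fun l => (col w l == Some k)%:R).

Lemma hit_ge0 w k : 0 <= hit w k.
Proof. by apply: avg_ge0 => l; rewrite ler0n. Qed.

Lemma sum_SomeE (o : option K) (u : pred K) :
  \sum_k (u k)%:R * (o == Some k)%:R = (if o is Some k then u k else false)%:R :> R.
Proof.
case: o => [k|]; last by rewrite big1 // => k _; rewrite mulr0.
rewrite (bigD1 k) //= eqxx mulr1 big1 ?addr0 // => l lk.
by rewrite (inj_eq (@Some_inj _)) eq_sym (negPf lk) mulr0.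
Qed.

Lemma load_hit w (u : pred K) :
  load hit w u = avg (fun l => (if col w l is Some k then u k else false)%:R).
Proof.
rewrite /load; under eq_bigr => k _ do rewrite -avgZ.
by rewrite -avg_sum; apply: eq_avg => l; rewrite sum_SomeE.
Qed.

Lemma hit_le1 w : \sum_k hit w k <= 1.
Proof.
have -> : \sum_k hit w k = load hit w xpredT.
  by apply: eq_bigr => k _; rewrite mul1r.
by rewrite load_hit; apply: (avg_le l0) => l; case: (col w l); rewrite ?ler01.
Qed.

Lemma avg_bool (f : bool -> R) : avg f = (f true + f false) / 2.
Proof. by rewrite /avg card_bool big_bool mulrC. Qed.

(* [kappa ^ odd n] is the convex combination of [1] and [(-1) ^ n] with weights
   [(1 + kappa) / 2] and [(1 - kappa) / 2]; the product over [k] is thereby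
   expanded into characters, whose averages factor over the blocks. *)
Lemma parity_bound (t M : R) (c : {ffun I -> bool} -> K -> nat) :
  1 <= t -> (forall k, \sum_(w | A w) hit w k <= t) ->
  M <= \sum_(w | A w) \sum_k hit w k * (1 - hit w k) ->
  avg (fun b : {ffun I -> bool} => avg (fun lv : {ffun I -> L} =>
    \prod_k kappa ^+ odd (c b k +
      \sum_(w | A w && ~~ b w) (col w (lv w) == Some k))%N))
  <= expR (- (M / (64 * t))).
Proof.
move=> t1 hit_t HM; have [k0 k1] := andP kappa_bnd.
(* Only colours on the side [K1] of a large cut are expanded into characters, the others being
   bounded by 1. Every chosen set then has load at most that of [K1], which keeps loads close to 1
   under control. *)
have [K1 cutK1] := max_cut A hit_ge0 hit_le1.
pose beta : R := (1 - kappa) / 2.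
have b1 : 1 / 8 <= beta <= 1 / 2 by rewrite /beta; lra.
have [b1l b1r] := andP b1.
pose wt (x : bool) : R := if x then beta else 1 - beta.
have wt0 x : 0 <= wt x by case: x => /=; lra.
pose u (T : {ffun K -> bool}) : pred K := fun k => T k && K1 k.
pose n b (lv : {ffun I -> L}) k := (c b k +
  \sum_(w | A w && ~~ b w) (col w (lv w) == Some k))%N.
have step1 k m : kappa ^+ odd m <= \sum_x wt x * (-1) ^+ ((x && K1 k) * m).
  rewrite big_bool /= mul0n expr0 mulr1; case: (K1 k).
    by rewrite mul1n -signr_odd /beta; case: (odd m); rewrite ?expr0 ?expr1; lra.
  rewrite mul0n expr0; apply: (@le_trans _ _ 1); last by lra.
  by rewrite exprn_ile1 //; lra.
have step2 (m : K -> nat) : \prod_k kappa ^+ odd (m k) <=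
    \sum_(T : {ffun K -> bool}) \prod_k wt (T k) * \prod_k (-1) ^+ (u T k * m k).
  apply: (@le_trans _ _ (\prod_k \sum_x wt x * (-1) ^+ ((x && K1 k) * m k))).
    by apply: ler_prod => k _; rewrite step1 exprn_ge0.
  by rewrite bigA_distr_bigA ler_sum // => T _; rewrite big_split.
have step3 b (T : {ffun K -> bool}) :
    avg (fun lv : {ffun I -> L} => \prod_k (-1) ^+ (u T k * n b lv k)) <=
    \prod_w (if A w && ~~ b w then `|1 - 2 * load hit w (u T)| else 1).
  pose g w l : R := if A w && ~~ b w then
    (-1) ^+ (if col w l is Some k then u T k else false) else 1.
  rewrite (@eq_avg _ _ _ (fun lv : {ffun I -> L} =>
      (\prod_k (-1) ^+ (u T k * c b k)) * \prod_w g w (lv w))); last first.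
    move=> lv; rewrite /n; under eq_bigr => k _ do rewrite mulnDr exprD.
    rewrite big_split /=; congr (_ * _).
    under eq_bigr => k _ do rewrite big_distrr /= expr_sum.
    rewrite exchange_big /= [RHS](bigID (fun w => A w && ~~ b w)) /=.
    rewrite [X in _ * X]big1 ?mulr1; last by move=> w /negPf h; rewrite /g h.
    apply: eq_bigr => w h; rewrite /g h.
    case: (col w (lv w)) => [k|]; last by rewrite big1 // => k _; rewrite muln0.
    rewrite (bigD1 k) //= eqxx muln1 big1 ?mulr1 // => l lk.
    by rewrite (inj_eq (@Some_inj _)) eq_sym (negPf lk) muln0.
  rewrite avgZ avg_prod; apply: le_trans (ler_norm _) _.
  rewrite normrM normr_prod big1 ?mul1r; last first.
    by move=> k _; rewrite normrX normrN1 expr1n.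
  rewrite normr_prod; apply: ler_prod => w _; rewrite normr_ge0 /= /g.
  case: ifP => _; last by rewrite (avg_const l0) normr1.
  rewrite load_hit -avgZ -{2}(avg_const l0 (1 : R)).
  rewrite -[- avg _]mulN1r -avgZ -avgD.
  rewrite le_eqVlt; apply/orP; left; apply/eqP; congr `| _ |.
  apply: eq_avg => l; case: (col w l) => [k|] /=;
    last by rewrite expr0 !mulr0 addr0.
  by case: (u T k); rewrite /= ?expr0 ?expr1 ?mulr1n ?mulr0n; lra.
pose s k := \sum_(w | A w) hit w k * (1 - load hit w K1).
have s0 k : 0 <= s k.
  apply: sumr_ge0 => w _; apply: mulr_ge0; first exact: hit_ge0.
  by rewrite subr_ge0 load_le1 //; [exact: hit_ge0 | exact: hit_le1].
have st k : s k <= t.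
  apply: le_trans (hit_t k); apply: ler_sum => w _.
  apply: ler_piMr; first exact: hit_ge0.
  by rewrite lerBlDr lerDl load_ge0 //; exact: hit_ge0.
have step4 (T : {ffun K -> bool}) :
    avg (fun b : {ffun I -> bool} =>
      \prod_w (if A w && ~~ b w then `|1 - 2 * load hit w (u T)| else 1)) <=
    \prod_k expR (- ((u T k)%:R * s k)).
  rewrite (avg_prod (fun w x => if A w && ~~ x then `|1 - 2 * load hit w (u T)|
    else 1)).
  rewrite (bigID A) /= [X in _ * X]big1 ?mulr1; last first.
    by move=> w /negPf ->; rewrite /= (avg_const true).
  rewrite -expR_sum sumrN /s.
  have -> : \sum_k (u T k)%:R * \sum_(w | A w) hit w k * (1 - load hit w K1) =
      \sum_(w | A w) load hit w (u T) * (1 - load hit w K1).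
    under eq_bigr => k _ do rewrite mulr_sumr.
    rewrite exchange_big; apply: eq_bigr => w _; rewrite /load mulr_suml.
    by apply: eq_bigr => k _; rewrite mulrA.
  rewrite -sumrN expR_sum; apply: ler_prod => w ->.
  rewrite /= avg_bool /=; apply/andP; split.
    by apply: mulr_ge0; rewrite ?invr_ge0 ?addr_ge0.
  have x0 : 0 <= load hit w (u T) by apply: load_ge0; exact: hit_ge0.
  have x1 : load hit w (u T) <= load hit w K1.
    by apply: load_le => [|k /andP[]//]; exact: hit_ge0.
  have x2 : load hit w K1 <= 1 by apply: load_le1; [exact: hit_ge0|exact: hit_le1].
  apply: le_trans (le1_expRN _).
  (* Averaging over the bit leaves 1 - min(x, 1 - x), and x (1 - y) is below both x and 1 - x since
     x <= y <= 1. *)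
  move: x0 x1 x2; set x := load hit w (u T); set y := load hit w K1 => x0 x1 x2.
  by have [h|h] := ler0P (1 - 2 * x); nra.
apply: (@le_trans _ _ (avg (fun b : {ffun I -> bool} =>
    avg (fun lv : {ffun I -> L} => \sum_(T : {ffun K -> bool})
      \prod_k wt (T k) * \prod_k (-1) ^+ (u T k * n b lv k))))).
  by apply: le_avg => b; apply: le_avg => lv; apply: step2.
under eq_avg => b.
  rewrite avg_sum; under eq_bigr => T _ do rewrite avgZ.
  over.
rewrite avg_sum.
apply: (@le_trans _ _ (\sum_(T : {ffun K -> bool})
    \prod_k (wt (T k) * expR (- ((u T k)%:R * s k))))).
  apply: ler_sum => T _; rewrite avgZ big_split /=.
  apply: ler_wpM2l; first by apply: prodr_ge0.
  by apply: le_trans (step4 T); apply: le_avg => b; apply: step3.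
rewrite -(bigA_distr_bigA (fun k x => wt x * expR (- ((x && K1 k)%:R * s k)))) /=.
apply: (@le_trans _ _ (\prod_k expR (- ((K1 k)%:R * s k * (beta / (2 * t)))))).
  apply: ler_prod => k _; rewrite big_bool /= mul0r oppr0 expR0 mulr1.
  rewrite addr_ge0 ?mulr_ge0 ?expR_ge0 //=; [|lra|lra].
  case: (K1 k); last by rewrite !mul0r oppr0 expR0; lra.
  rewrite !mul1r; apply: le_trans (le1_expRN _).
  have y01 : 0 <= s k / t <= 1.
    by rewrite divr_ge0 ?ler_pdivrMr ?mul1r ?st ?andbT //; lra.
  have := expRN_le y01.
  have : expR (- s k) <= expR (- (s k / t)).
    rewrite ler_expR lerN2 ler_pdivrMr; last lra.
    by have := s0 k; nra.
  have -> : s k * (beta / (2 * t)) = beta * (s k / t / 2).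
    by field; apply/eqP; lra.
  set y := s k / t; nra.
rewrite -expR_sum ler_expR sumrN lerN2 -mulr_suml.
have -> : \sum_k (K1 k)%:R * s k =
    \sum_(w | A w) load hit w K1 * (1 - load hit w K1).
  under eq_bigr => k _ do rewrite mulr_sumr.
  rewrite exchange_big; apply: eq_bigr => w _; rewrite /load mulr_suml.
  by apply: eq_bigr => k _; rewrite mulrA.
move: cutK1 HM; set X := \sum_(w | A w) \sum_k _; set Y := \sum_(w | A w) _ * _.
move=> XY MX.
have Y0 : 0 <= Y.
  by apply: sumr_ge0 => w _; rewrite mulr_ge0 ?subr_ge0 ?load_ge0 ?load_le1 //;
    [exact: hit_ge0 | exact: hit_ge0 | exact: hit_le1].
rewrite ler_pdivrMr; last lra.
(* The 64 is 4 from the cut, times 2 from [expRN_le], times 8 from [beta >= 1 / 8]. *)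
have -> : Y * (beta / (2 * t)) * (64 * t) = 32 * beta * Y.
  by field; apply/eqP; lra.
nra.
Qed.

End Parity.

(** * Three regimes for the loads *)

Section Trichotomy.
Variables (R : realType) (I K : finType) (A : pred I) (a : I -> K -> R) (t M : R).
Hypotheses (a_ge0 : forall w k, 0 <= a w k) (a_le1 : forall w, \sum_k a w k <= 1).

Definition dominated w := [exists k, 3 / 4 < a w k].

(** A block that is not dominated has a <= 4 a (1 - a) for each share [a], and a dominated one has
    total at most 1; so a small spread forces many dominated blocks. *)
Lemma trichotomy : M / 2 <= \sum_(w | A w) \sum_k a w k ->
  [\/ exists k, t <= \sum_(w | A w) a w k,
      (forall k, \sum_(w | A w) a w k <= t) /\
        M / 16 <= \sum_(w | A w) \sum_k a w k * (1 - a w k) |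
      (forall k, \sum_(w | A w) a w k <= t) /\
        M / 4 <= (\sum_(w | A w) dominated w)%:R].
Proof.
move=> HM.
have [/existsP[k tk]|/existsPn big_t] :=
    boolP [exists k, t <= \sum_(w | A w) a w k].
  by constructor 1; exists k.
have {}big_t k : \sum_(w | A w) a w k <= t by have := big_t k; rewrite -ltNge => /ltW.
have [h|h] := leP (M / 16) (\sum_(w | A w) \sum_k a w k * (1 - a w k)).
  by constructor 2.
constructor 3; split=> //.
have : \sum_(w | A w) \sum_k a w k <=
    4 * (\sum_(w | A w) \sum_k a w k * (1 - a w k)) + (\sum_(w | A w) dominated w)%:R.
  rewrite natr_sum mulr_sumr -big_split; apply: ler_sum => w _ /=.
  have q0 k : 0 <= a w k * (1 - a w k).
    rewrite mulr_ge0 // subr_ge0; apply: le_trans (a_le1 w).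
    by rewrite (bigD1 k) //= lerDl sumr_ge0.
  have [_|/existsPn nd] := boolP (dominated w).
    apply: le_trans (a_le1 w) _; rewrite lerDr mulr_ge0 // sumr_ge0 //.
  rewrite addr0 mulr_sumr; apply: ler_sum => k _.
  by have := nd k; rewrite -leNgt => ak; have := a_ge0 w k; nra.
lra.
Qed.

Hypotheses (t_gt0 : 0 < t) (load_t : forall k, \sum_(w | A w) a w k <= t).

Lemma dominating_inj w k k' : 3 / 4 < a w k -> 3 / 4 < a w k' -> k = k'.
Proof.
move=> h h'; apply/eqP/negPn/negP => kk'.
have := a_le1 w; rewrite (bigD1 k) //= (bigD1 k') 1?eq_sym //=.
have : 0 <= \sum_(i | (i != k) && (i != k')) a w i by apply: sumr_ge0.
lra.
Qed.

Lemma dominating_system (i0 : I) : exists (V : {set K}) (f : K -> I),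
  [/\ {in V &, injective f}, forall k, k \in V -> A (f k) /\ 3 / 4 < a (f k) k &
      (\sum_(w | A w) dominated w)%:R <= 4 / 3 * t * #|V|%:R].
Proof.
pose V := [set k | [exists w, A w && (3 / 4 < a w k)]]%SET.
have ex k : exists w, k \in V -> A w && (3 / 4 < a w k).
  have [/[dup] kV|kV] := boolP (k \in V); last by exists i0.
  by rewrite inE => /existsP[w h]; exists w.
have [f fP] := fin_all_exists ex; exists V, f; split.
- move=> k k' /fP /andP[_ h] /fP /andP[_ h'] ff.
  by apply: dominating_inj h _; rewrite ff.
- by move=> k /fP /andP[].
rewrite natr_sum.
apply: (@le_trans _ _ (\sum_(k in V) \sum_(w | A w) 4 / 3 * a w k)).
  rewrite exchange_big /=; apply: ler_sum => w Aw.
  have [/existsP[k h]|_] := boolP (dominated w); last first.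
    by apply: sumr_ge0 => k _; rewrite mulr_ge0.
  have kV : k \in V by rewrite inE; apply/existsP; exists w; rewrite Aw.
  rewrite (bigD1 k) //=; apply: (@le_trans _ _ (4 / 3 * a w k)); first by lra.
  by rewrite lerDl sumr_ge0 // => l _; rewrite mulr_ge0.
rewrite mulr_natr -sumr_const; apply: ler_sum => k _.
by rewrite -mulr_sumr ler_wpM2l.
Qed.

End Trichotomy.

(** * Relative rank *)

Section RelativeRank.
Variables (R : realType) (F : fieldType) (X : finType) (kappa : R).
Hypotheses (kappa_gt0 : 0 < kappa) (kappa2 : kappa ^+ 2 = 1 / 2).

Implicit Types (rho : X -> status) (S : pred X) (phi : bpoint X -> F).

Definition is_live (s : status) := if s is inr _ then true else false.

Definition live rho S := (\sum_(x | S x) is_live (rho x))%N.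

Lemma live_side rho S : live rho S = (side rho S true + side rho S false)%N.
Proof.
rewrite /live /side -big_split; apply: eq_bigr => x _.
by case: (rho x) => [?|[]].
Qed.

Lemma live_color (K : finType) (col : X -> K) rho S :
  live rho S = (\sum_k live rho (fun x => S x && (col x == k)))%N.
Proof. by rewrite /live (partition_big col xpredT). Qed.

Definition relrank rho S phi : R :=
  (\rank (evmx rho phi))%:R * kappa ^+ live rho S.

Lemma kappa_le : kappa <= 3 / 4.
Proof. by rewrite leNgt; apply/negP => h; move: kappa2; rewrite expr2; nra. Qed.

Lemma relrank_ge0 rho S phi : 0 <= relrank rho S phi.
Proof. by apply: mulr_ge0; rewrite ?ler0n ?exprn_ge0 // ltW. Qed.

(** The rank is at most 2 to the smaller side, leaving [kappa] to the difference of the sides, which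
    has the parity of the number of live variables. *)
Lemma relrank_parity rho S phi : depends_on S phi ->
  relrank rho S phi <= kappa ^+ odd (live rho S).
Proof.
move=> phiS; rewrite /relrank live_side.
set y := side rho S true; set z := side rho S false.
have k1 : kappa <= 1 by have := kappa_le; lra.
have k0 : 0 <= kappa by apply: ltW.
have main r s n : (r <= 2 ^ s)%N -> (s <= n)%N ->
    r%:R * kappa ^+ (s + n) <= kappa ^+ odd (s + n).
  move=> rs sn; have -> : (s + n = 2 * s + (n - s))%N by lia.
  rewrite exprD exprM kappa2 mulrA.
  have -> : odd (2 * s + (n - s)) = odd (n - s) by rewrite oddD mul2n odd_double.
  apply: (@le_trans _ _ (kappa ^+ (n - s))).
    rewrite ler_piMl ?exprn_ge0 // expr_div_n expr1n mul1r ler_pdivrMr ?exprn_gt0 //.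
    by rewrite mul1r -natrX ler_nat.
  by apply: ler_wiXn2l => //; case: (n - s)%N => [|k] //=; case: odd.
have [yz|zy] := leqP y z; first by apply: main; [exact: rank_evmx_side|].
by rewrite addnC; apply: main; [exact: rank_evmx_side|exact: ltnW].
Qed.

Lemma relrank_le1 rho S phi : depends_on S phi -> relrank rho S phi <= 1.
Proof.
move=> h; apply: le_trans (relrank_parity rho h) _.
by apply: exprn_ile1; [exact: ltW|have := kappa_le; lra].
Qed.

Lemma relrank_affine rho S phi : affine_on S phi ->
  relrank rho S phi <= 2 * kappa ^+ live rho S.
Proof.
move=> h; apply: ler_wpM2r; first by rewrite exprn_ge0 // ltW.
by rewrite ler_nat; exact: rank_evmx_affine h.
Qed.

Lemma relrank_sum rho S (I : finType) (c : I -> F) (phi : I -> bpoint X -> F) :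
  relrank rho S (fun p => \sum_i c i * phi i p) <= \sum_i relrank rho S (phi i).
Proof.
rewrite /relrank -mulr_suml; apply: ler_wpM2r; first by rewrite exprn_ge0 // ltW.
rewrite -natr_sum ler_nat; apply: leq_trans (rank_evmx_sum _ _) _.
by apply: leq_sum => i _; apply: rank_evmx_scale.
Qed.

Lemma relrank_prod rho S (K : finType) (col : X -> K) (phi : K -> bpoint X -> F) :
  relrank rho S (fun p => \prod_k phi k p) <=
  \prod_k relrank rho (fun x => S x && (col x == k)) (phi k).
Proof.
rewrite /relrank big_split /= -expr_sum -live_color.
apply: ler_wpM2r; first by rewrite exprn_ge0 // ltW.
by rewrite -natr_prod ler_nat; exact: rank_evmx_prod.
Qed.

End RelativeRank.

(** * Embedded copies and their densities *)

Section Embedding.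
Variables (R : realType) (X : finType) (n : nat).

Definition dens D (iota : Xvar n.+1 D -> X) (S : pred X) : R :=
  avg (fun l : leaf n D => (S (iota (leafvar l)))%:R).

Lemma dens_ge0 D (iota : Xvar n.+1 D -> X) S : 0 <= dens iota S.
Proof. by apply: avg_ge0 => l; rewrite ler0n. Qed.

(* [rho] acts as the random restriction [restr] on the disjoint copies
   [iota w] of [Xvar n.+1 D] with [w] in [A], and is constant elsewhere. *)
Definition embeds D (W : finType) (A : pred W) (iota : W -> Xvar n.+1 D -> X)
    (rho : omega n D W -> X -> status) : Prop :=
  [/\ forall w w' y y', iota w y = iota w' y' -> w = w' /\ y = y',
      forall o w y, A w -> rho o (iota w y) = restr o w y &
      forall o o' x, (forall w y, A w -> x != iota w y) -> rho o x = rho o' x].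

Lemma embed_imageP D (W : finType) (A : pred W) (iota : W -> Xvar n.+1 D -> X) x :
  (exists w y, A w /\ x = iota w y) \/ (forall w y, A w -> x != iota w y).
Proof.
have [/existsP[w /andP[Aw /existsP[y /eqP ->]]]|h] :=
    boolP [exists w, A w && [exists y, x == iota w y]].
  by left; exists w, y.
right=> w y Aw; apply: contra h => xy; apply/existsP; exists w.
by rewrite Aw; apply/existsP; exists y.
Qed.

Section Step.
Variables (D : nat) (W : finType) (A : pred W).
Variables (iota : W -> Xvar n.+1 D.+1 -> X) (rho : omega n D.+1 W -> X -> status).
Hypothesis emb : embeds A iota rho.

Let I := (W * 'I_n.+1)%type.

Definition sub_iota (w : I) (y : Xvar n.+1 D) : X := iota w.1 (w.2, 0, y).

Lemma sub_iota_inj w w' y y' : sub_iota w y = sub_iota w' y' -> w = w' /\ y = y'.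
Proof.
case: emb => inj _ _; case: w w' => [v i] [v' i'] /inj[/= -> [-> ->]].
by [].
Qed.

(** Once the top bits and leaves are fixed, randomness remains only in the surviving blocks, which
    again form a forest. *)
Lemma embeds_sub (b : {ffun I -> bool}) (lv : {ffun I -> leaf n D}) :
  embeds (fun w : I => A w.1 && b w) sub_iota (fun o => rho (b, lv, o)).
Proof.
case: emb => inj H1 H2; split; first exact: sub_iota_inj.
  by move=> o [v i] y /andP[/= Av bw]; rewrite /sub_iota H1 //= bw.
move=> o o' x nx; have [[v [[[i j] y] [Av xE]]]|] := embed_imageP A iota x; last exact: H2.
rewrite xE !H1 //=; case: (altP (j =P 0)) => // j0; case: ifP => // bw.
have := nx (v, i) y; rewrite /= Av bw => /(_ isT).
by rewrite xE j0 /sub_iota eqxx.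
Qed.

(** A density is the mean of those of its [n.+1] subblocks, so mass 1/2 becomes [n.+1 / 2], the
    input of [trichotomy]. *)
Lemma sum_dens S :
  \sum_(w : I | A w.1) dens (sub_iota w) S = n.+1%:R * \sum_(v | A v) dens (iota v) S.
Proof.
transitivity (\sum_(v | A v) \sum_(i < n.+1) dens (sub_iota (v, i)) S).
  by rewrite pair_big_dep; apply: eq_big => [[v i]|[v i] _] //=; rewrite andbT.
rewrite mulr_sumr; apply: eq_bigr => v _.
have -> : dens (iota v) S = avg (fun i : 'I_n.+1 => dens (sub_iota (v, i)) S).
  exact: (avg_pair (T1 := 'I_n.+1) (T2 := leaf n D)).
by rewrite /avg card_ord mulrA mulfV ?mul1r // pnatr_eq0.
Qed.

Lemma avg_omega (f : omega n D.+1 W -> R) :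
  avg f = avg (fun b => avg (fun lv => avg (fun o => f (b, lv, o)))).
Proof. by rewrite avg_pair avg_pair. Qed.

(* Only the random leaves of the factors of the form [y + z] matter: every other
   contribution to the number of live variables is frozen by [b] and [o]. *)
Lemma live_decomp b o S : exists c : nat, forall lv,
  live (rho (b, lv, o)) S =
  (c + \sum_(w : I | A w.1 && ~~ b w) S (sub_iota w (leafvar (lv w))))%N.
Proof.
case: emb => inj H1 H2.
pose P : pred (I * Xvar n.+1 D) := fun p => A p.1.1 && ~~ b p.1.
pose h (p : I * Xvar n.+1 D) := sub_iota p.1 p.2.
pose B : pred X := fun x => x \in [set h p | p in P].
exists (live (rho (b, [ffun=> leaf0 n D], o)) (fun x => S x && ~~ B x)) => lv.
rewrite /live (bigID B) /= addnC; congr addn.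
  apply: eq_bigr => x /andP[_ /negP nB]; congr (nat_of_bool (is_live _)).
  have [[v [[[i j] y] [Av xE]]]|] := embed_imageP A iota x; last exact: H2.
  rewrite xE !H1 //=; case: (altP (j =P 0)) => // j0; case: ifP => // bw.
  case: nB; apply/imsetP; exists ((v, i), y); first by rewrite unfold_in /P /= Av bw.
  by rewrite xE j0.
under eq_bigl => x do rewrite andbC.
rewrite big_mkcondr big_imset /=; last first.
  by move=> [w y] [w' y'] _ _ /sub_iota_inj /= [-> ->].
transitivity (\sum_(w : I | A w.1 && ~~ b w) \sum_(y : Xvar n.+1 D)
   if S (h (w, y)) then (is_live (rho (b, lv, o) (h (w, y))) : nat) else 0)%N.
  by rewrite pair_big_dep; apply: eq_big => [[w y]|[w y] _] //=; rewrite andbT.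
apply: eq_bigr => -[v i] /andP[/= Av nb].
have liveE y : is_live (rho (b, lv, o) (h (v, i, y))) = (y == leafvar (lv (v, i))).
  rewrite /h /sub_iota H1 //= (negPf nb) /single.
  by case: (y == _).
rewrite (bigD1 (leafvar (lv (v, i)))) //= liveE eqxx big1 ?addn0.
  by rewrite /h /=; case: (S _).
by move=> y /negPf yl; rewrite liveE yl; case: ifP.
Qed.

End Step.

End Embedding.

(** * One product gate under the restriction *)

Section ProductTerm.
Variables (R : realType) (F : fieldType) (X : finType) (n : nat) (kappa : R).
Hypotheses (kappa_gt0 : 0 < kappa) (kappa2 : kappa ^+ 2 = 1 / 2).
Variables (D : nat) (W : finType) (A : pred W).
Variables (iota : W -> Xvar n.+1 D.+1 -> X) (rho : omega n D.+1 W -> X -> status).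
Hypothesis emb : embeds A iota rho.
Variables (S : pred X) (K : finType) (col : X -> K) (psi : K -> bpoint X -> F).
Let cls k : pred X := fun x => S x && (col x == k).
Hypothesis psi_cls : forall k, depends_on (cls k) (psi k).

Let I := (W * 'I_n.+1)%type.
Let sub := sub_iota iota.
Let share (w : I) k : R := dens R (sub w) (cls k).
Let phi p : F := \prod_k psi k p.

Let k34 : 0 <= kappa <= 3 / 4.
Proof. by rewrite ltW // (kappa_le kappa2). Qed.

Let color (w : I) (l : leaf n D) : option K :=
  let x := sub w (leafvar l) in if S x then Some (col x) else None.

Lemma colorE w l k : (color w l == Some k) = cls k (sub w (leafvar l)).
Proof. by rewrite /color /cls; case: (S _). Qed.

Lemma hit_dens w k : hit R color w k = share w k.
Proof. by apply: eq_avg => l; rewrite colorE. Qed.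

Lemma share_ge0 w k : 0 <= share w k.
Proof. exact: dens_ge0. Qed.

Lemma sum_share_le1 w : \sum_k share w k <= 1.
Proof.
under eq_bigr => k _ do rewrite -hit_dens.
by apply: hit_le1; exact: leaf0.
Qed.

Lemma share_itv w k : 0 <= share w k <= 1.
Proof.
rewrite share_ge0 /=; apply: le_trans (sum_share_le1 w); rewrite (bigD1 k) //= lerDl.
by apply: sumr_ge0 => l _; apply: share_ge0.
Qed.

Lemma sum_share : \sum_(w : I | A w.1) \sum_k share w k =
  n.+1%:R * \sum_(v | A v) dens R (iota v) S.
Proof.
rewrite -sum_dens; apply: eq_bigr => w _; rewrite /share /dens -avg_sum.
apply: eq_avg => l; rewrite /cls; set x := sub_iota _ _ _; rewrite -/x.
rewrite (bigD1 (col x)) //= eqxx andbT big1 ?addr0 // => k.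
by rewrite eq_sym => /negPf ->; rewrite andbF.
Qed.

Lemma relrank_class o k :
  relrank kappa (rho o) S phi <= relrank kappa (rho o) (cls k) (psi k).
Proof.
apply: le_trans (relrank_prod kappa_gt0 _ _ col psi) _.
rewrite (bigD1 k) //= ler_piMr ?relrank_ge0 //.
apply: prodr_ile1 => l _; rewrite relrank_ge0 //=.
exact: (relrank_le1 kappa_gt0 kappa2 _ (@psi_cls l)).
Qed.

Lemma avg_relrank_parity t M : 1 <= t ->
  (forall k, \sum_(w : I | A w.1) share w k <= t) ->
  M <= \sum_(w : I | A w.1) \sum_k share w k * (1 - share w k) ->
  avg (fun o => relrank kappa (rho o) S phi) <= expR (- (M / (64 * t))).
Proof.
move=> t1 at_ HM; rewrite avg_omega.
have [c cE] : exists c : {ffun I -> bool} -> omega n D I -> K -> nat,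
    forall b o k lv, live (rho (b, lv, o)) (cls k) =
    (c b o k + \sum_(w : I | A w.1 && ~~ b w) cls k (sub w (leafvar (lv w))))%N.
  have h b o := fin_all_exists (fun k => live_decomp emb b o (cls k)).
  have {}h b := fin_all_exists (h b).
  by have [c cE] := fin_all_exists h; exists c.
under eq_avg => b do rewrite avg_exchange.
rewrite avg_exchange; apply: (avg_le (omega_inhabited n D I)) => o.
apply: le_trans (parity_bound (leaf0 n D) k34 (fun b => c b o) t1 _ _).
- apply: le_avg => b; apply: le_avg => lv.
  apply: le_trans (relrank_prod kappa_gt0 _ _ col psi) _.
  apply: ler_prod => k _; rewrite relrank_ge0 //=.
  apply: le_trans (relrank_parity kappa_gt0 kappa2 _ (@psi_cls k)) _.
  rewrite cE le_eqVlt; apply/orP; left; apply/eqP; congr (_ ^+ odd (_ + _)%N).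
  by apply: eq_bigr => w _; rewrite -colorE.
- by move=> k; under eq_bigr => w _ do rewrite hit_dens; apply: at_.
- under eq_bigr => w _ do under eq_bigr => k _ do rewrite hit_dens.
  exact: HM.
Qed.

(** The factor has rank at most 2, while each block with bit false whose leaf falls in class [k]
    contributes a [kappa]. Its mean factor is at most 1 - share/8, as 1 - [kappa] is at least
    1/4. *)
Lemma avg_relrank_affine t k : affine_on (cls k) (psi k) ->
  t <= \sum_(w : I | A w.1) share w k ->
  avg (fun o => relrank kappa (rho o) S phi) <= 2 * expR (- (t / 8)).
Proof.
move=> aff tk; rewrite avg_omega.
pose g (w : I) (x : bool) (l : leaf n D) : R :=
  if A w.1 && ~~ x && cls k (sub w (leafvar l)) then kappa else 1.
apply: (@le_trans _ _ (avg (fun b : {ffun I -> bool} =>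
    avg (fun lv : {ffun I -> leaf n D} => 2 * \prod_w g w (b w) (lv w))))).
  apply: le_avg => b; apply: le_avg => lv; apply: (avg_le (omega_inhabited n D I)) => o.
  apply: le_trans (relrank_class _ k) _.
  apply: le_trans (relrank_affine kappa_gt0 _ aff) _.
  rewrite ler_wpM2l //; have [c ->] := live_decomp emb b o (cls k).
  rewrite exprD expr_sum [leRHS](bigID (fun w : I => A w.1 && ~~ b w)) /=.
  rewrite [X in _ <= _ * X]big1 ?mulr1; last by move=> w /negPf h; rewrite /g h.
  apply: (@le_trans _ _ (1 * \prod_(w : I | A w.1 && ~~ b w)
      kappa ^+ cls k (sub w (leafvar (lv w))))).
    apply: ler_wpM2r; first by apply: prodr_ge0 => w _; rewrite exprn_ge0 // ltW.
    by have [k0 k1] := andP k34; apply: exprn_ile1; lra.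
  rewrite mul1r le_eqVlt; apply/orP; left; apply/eqP; apply: eq_bigr => w h.
  by rewrite /g h /=; case: (cls k _); rewrite ?expr0 ?expr1.
under eq_avg => b do rewrite avgZ (avg_prod (fun w => g w (b w))).
rewrite avgZ (avg_prod (fun w x => avg (g w x))) ler_wpM2l //.
apply: (@le_trans _ _ (expR (- (\sum_(w : I | A w.1) share w k / 8)))); last first.
  by rewrite ler_expR lerN2 -mulr_suml ler_wpM2r // invr_ge0.
rewrite -sumrN expR_sum [leRHS]big_mkcond; apply: ler_prod => w _.
have g0 x l : 0 <= g w x l by rewrite /g; case: ifP => _; rewrite ?ler01 // ltW.
apply/andP; split; first by apply: avg_ge0 => x; apply: avg_ge0.
rewrite avg_bool; case: ifP => Aw; last first.
  by rewrite /g Aw /= !(avg_const (leaf0 n D)); lra.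
have -> : avg (g w true) = 1.
  by rewrite /g andbF /= (avg_const (leaf0 n D)).
have -> : avg (g w false) = 1 + (kappa - 1) * share w k.
  rewrite /share /dens -avgZ -{1}(avg_const (leaf0 n D) (1 : R)) -avgD.
  apply: eq_avg => l; rewrite /g Aw /=; case: (cls k _) => /=; lra.
have [k0 k1] := andP k34; apply: le_trans (le1_expRN _); have := share_ge0 w k; nra.
Qed.

Let bad (b : {ffun I -> bool}) :=
  ~~ [exists k, 1 / 2 <= \sum_(w : I | A w.1 && b w) share w k].

(** If no class keeps mass 1/2 in the surviving blocks, the relative rank is bounded by 1 and
    charged to [bad]; otherwise all factors but the heavy one are dropped. *)
Lemma avg_relrank_rec (e : R) : 0 <= e ->
  (forall (b : {ffun I -> bool}) (lv : {ffun I -> leaf n D}) k,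
     1 / 2 <= \sum_(w : I | A w.1 && b w) share w k ->
     avg (fun o => relrank kappa (rho (b, lv, o)) (cls k) (psi k)) <= e) ->
  avg (fun o => relrank kappa (rho o) S phi) <= avg (fun b => (bad b)%:R) + e.
Proof.
move=> e0 rec; rewrite avg_omega.
rewrite -(avg_const (finfun (fun _ : I => true)) e) -avgD; apply: le_avg => b.
apply: (avg_le (finfun (fun _ : I => leaf0 n D))) => lv.
have [/existsP[k hk]|nb] := boolP [exists k, 1 / 2 <= \sum_(w : I | A w.1 && b w) share w k].
  apply: le_trans (_ : e <= _); last by rewrite lerDr ler0n.
  by apply: le_trans (rec b lv k hk); apply: le_avg => o; apply: relrank_class.
rewrite /bad nb; apply: (@le_trans _ _ 1); last by rewrite lerDl.
apply: (avg_le (omega_inhabited n D I)) => o.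
apply: relrank_le1 => // p q pq; apply: eq_bigr => k _; apply: psi_cls => x.
by move=> /andP[Sx _]; apply: pq.
Qed.

(** Exponential moments: [bad] makes exp(-mass) at least 1/2, and a block of share [a] has mean (1 +
    exp(-a))/2 <= 1 - a/4. *)
Lemma avg_bad_mass t k : t <= \sum_(w : I | A w.1) share w k ->
  avg (fun b => (bad b)%:R) <= 2 * expR (- (t / 4)).
Proof.
move=> tk.
apply: (@le_trans _ _ (avg (fun b : {ffun I -> bool} =>
    2 * \prod_w (if A w.1 && b w then expR (- share w k) else 1)))).
  apply: le_avg => b; rewrite -big_mkcond -expR_sum sumrN.
  have [|_] := boolP (bad b); last by rewrite mulr_ge0 ?expR_ge0.
  rewrite {1}/bad negb_exists => /forallP/(_ k); rewrite -ltNge => h.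
  set m := \sum_(w : I | _) _ in h *.
  have : expR (- (1 / 2)) <= expR (- m) by rewrite ler_expR lerN2 ltW.
  have := @le1_expRN R (1 / 2); rewrite mulr1n; lra.
rewrite avgZ (avg_prod (fun (w : I) x => if A w.1 && x then expR (- share w k) else 1)).
rewrite ler_wpM2l //.
apply: (@le_trans _ _ (expR (- (\sum_(w : I | A w.1) share w k / 4)))); last first.
  by rewrite ler_expR lerN2 -mulr_suml ler_wpM2r // invr_ge0.
rewrite -sumrN expR_sum [leRHS]big_mkcond; apply: ler_prod => w _.
rewrite avg_bool andbF; case: (A w.1) => /=; last by lra.
have e0 := expR_ge0 (- share w k); apply/andP; split; first by lra.
apply: le_trans (le1_expRN _); have := expRN_le (share_itv w k); lra.
Qed.

(** A single surviving dominated block already carries mass above 1/2, so [bad] requires all of them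
    to die. *)
Lemma avg_bad_dominated (M : R) : M / 4 <= (\sum_(w : I | A w.1) dominated share w)%:R ->
  avg (fun b => (bad b)%:R : R) <= expR (- (M / 8)).
Proof.
move=> HM.
apply: (@le_trans _ _ (avg (fun b : {ffun I -> bool} =>
    \prod_w (if A w.1 && dominated share w then (~~ b w)%:R else 1)))).
  apply: le_avg => b; have [|_] := boolP (bad b); last first.
    by apply: prodr_ge0 => w _; case: ifP; rewrite ?ler0n.
  rewrite {1}/bad negb_exists => /forallP nb; rewrite big1 // => w _.
  case: ifP => // /andP[Aw /existsP[k ak]]; case bw: (b w) => //.
  have := nb k; rewrite (bigD1 w) /= ?Aw //.
  have : 0 <= \sum_(i : I | (A i.1 && b i) && (i != w)) share i k.
    by apply: sumr_ge0 => i _; apply: share_ge0.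
  by rewrite -ltNge; lra.
rewrite (avg_prod (fun (w : I) x => if A w.1 && dominated share w then (~~ x)%:R else 1)).
apply: (@le_trans _ _ (expR (- ((\sum_(w : I | A w.1) dominated share w)%:R / 2)))); last first.
  by rewrite ler_expR lerN2; lra.
rewrite natr_sum mulr_suml -sumrN expR_sum [leRHS]big_mkcond; apply: ler_prod => w _.
rewrite avg_bool; case: (A w.1) => /=; last by lra.
case: (dominated share w) => /=; last by rewrite mul0r oppr0 expR0; lra.
by have := @le1_expRN R (1 / 2); rewrite mulr0n mulr1n; lra.
Qed.

End ProductTerm.

(** * Products of affine factors *)

Section BottomLevel.
Variables (R : realType) (F : fieldType) (X : finType) (n : nat) (kappa : R).
Hypotheses (kappa_gt0 : 0 < kappa) (kappa2 : kappa ^+ 2 = 1 / 2).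
Variables (W : finType) (A : pred W).
Variables (iota : W -> Xvar n.+1 1 -> X) (rho : omega n 1 W -> X -> status).
Hypothesis emb : embeds A iota rho.
Variables (S : pred X) (K : finType) (col : X -> K) (psi : K -> bpoint X -> F).
Let cls k : pred X := fun x => S x && (col x == k).
Hypothesis psi_affine : forall k, affine_on (cls k) (psi k).

Let I := (W * 'I_n.+1)%type.
Let share (w : I) k : R := dens R (sub_iota iota w) (cls k).

(** A block is here a copy of [P0] with four leaves, so density above 3/4 means all four. *)
Lemma live_dominated (o : omega n 1 W) (w : I) T :
  A w.1 -> o.1.1 w -> 3 / 4 < dens R (sub_iota iota w) T -> (4 <= live (rho o) T)%N.
Proof.
case: emb => inj H1 _; case: w => v i /= Av bw dT.
have Tl (l : leaf n 0) : T (sub_iota iota (v, i) (leafvar l)).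
  apply/negPn/negP => nT; move: dT; rewrite /dens /avg card_ord ltNge => /negP; apply.
  rewrite (bigD1 l) //= (negPf nT) add0r ler_pdivrMl //.
  have -> : 4%:R * (3 / 4) = 3 :> R by lra.
  apply: (@le_trans _ _ (\sum_(j : 'I_4 | j != l) 1)).
    by apply: ler_sum => j _; case: (T _); rewrite ?ler01.
  by rewrite sumr_const (cardC1 l) card_ord.
have inj4 : injective (fun l : 'I_4 => sub_iota iota (v, i) (@leafvar n 0 l)).
  by move=> l l' /(sub_iota_inj emb) [_ /(@leafvar_inj n 0)].
have := card_imset predT inj4; rewrite card_ord => {1}<-.
rewrite /live -big_mkcondr sum1_card; apply: subset_leq_card.
apply/fintype.subsetP => x /imsetP[l _ ->]; rewrite unfold_in Tl /= /sub_iota H1 //=.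
by rewrite bw.
Qed.

(** For each colour of [V], survival of its chosen block brings the affine factor down to 2
    [kappa]^4 = 1/2. The blocks are distinct, hence independent, with mean 3/4 each. *)
Lemma avg_relrank_dominated (t M : R) : 0 < t -> 0 < M ->
  (forall k, \sum_(w : I | A w.1) share w k <= t) ->
  M / 4 <= (\sum_(w : I | A w.1) dominated share w)%:R ->
  avg (fun o => relrank kappa (rho o) S (fun p => \prod_k psi k p)) <=
    expR (- (3 * M / (64 * t))).
Proof.
move=> t0 M0 at_ HM.
have a0 w k : 0 <= share w k by apply: dens_ge0.
have a1 w : \sum_k share w k <= 1 by apply: (@sum_share_le1 R X n 0 W iota S K col).
have [i0 _] : exists i0 : I, true.
  have [i0 _|noI] := pickP (@predT I); first by exists i0.
  by move: HM; rewrite big1 => [|w]; [rewrite mulr0n; lra|have := noI w].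
have [V [f [injf fV cardV]]] := dominating_system a0 a1 at_ i0.
pose g (w : I) (x : bool) : R := if (w \in f @: V) && x then 1 / 2 else 1.
rewrite avg_omega; apply: (@le_trans _ _ (avg (fun b : {ffun I -> bool} =>
    \prod_w g w (b w)))).
  apply: le_avg => b; apply: (avg_le (finfun (fun _ : I => leaf0 n 0))) => lv.
  apply: (avg_le tt) => o.
  apply: le_trans (relrank_prod kappa_gt0 _ _ col psi) _.
  rewrite [leRHS](bigID (mem (f @: V))) /= [X in _ <= _ * X]big1 ?mulr1; last first.
    by move=> w /negPf h; rewrite /g h.
  rewrite big_imset //= [leRHS]big_mkcond; apply: ler_prod => k _.
  rewrite relrank_ge0 //=; case: ifP => kV; last first.
    by apply: (relrank_le1 kappa_gt0 kappa2); apply: affine_depends; apply: psi_affine.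
  rewrite /g imset_f //=; case: ifP => bf; last first.
    by apply: (relrank_le1 kappa_gt0 kappa2); apply: affine_depends; apply: psi_affine.
  have [Af af] := fV k kV.
  have := live_dominated (o := (b, lv, o)) Af bf af => l4.
  apply: le_trans (relrank_affine kappa_gt0 _ (psi_affine k)) _.
  have k0 := ltW kappa_gt0; have k34 := kappa_le kappa2.
  have : kappa ^+ live (rho (b, lv, o)) (cls k) <= kappa ^+ 4.
    by apply: ler_wiXn2l => //; lra.
  by rewrite (exprM kappa 2 2) kappa2 /cls; lra.
rewrite (avg_prod g).
have gE w : avg (g w) = if w \in f @: V then 3 / 4 else 1.
  by rewrite avg_bool /g; case: (w \in _) => /=; lra.
under eq_bigr => w _ do rewrite gE.
rewrite -big_mkcond prodr_const card_in_imset //.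
apply: (@le_trans _ _ (expR (- (1 / 4)) ^+ #|V|)).
  have h : 3 / 4 <= expR (- (1 / 4)) :> R by apply: le_trans (le1_expRN _); lra.
  by rewrite lerXn2r ?nnegrE ?expR_ge0 //; lra.
rewrite -expRM_natr ler_expR mulNr lerN2 ler_pdivrMr; last by lra.
by have := le_trans HM cardV; lra.
Qed.

End BottomLevel.

(** * Induction on the product-depth *)

Section CoreBound.
Variables (R : realType) (F : fieldType) (X : finType) (n s : nat) (kappa t : R).
Hypotheses (kappa_gt0 : 0 < kappa) (kappa2 : kappa ^+ 2 = 1 / 2).
Hypotheses (t_ge1 : 1 <= t) (t2 : t ^+ 2 = n.+1%:R).

(** An error covering every case; 1024 is 16 from [trichotomy] times 64 from [parity_bound]. *)
Let eta := 2 * expR (- (t / 1024)).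

Lemma le_eta x : t / 1024 <= x -> expR (- x) <= eta.
Proof.
move=> h; have := expR_ge0 (- (t / 1024)).
have : expR (- x) <= expR (- (t / 1024)) by rewrite ler_expR lerN2.
by rewrite /eta; lra.
Qed.

Lemma le_eta2 x : t / 1024 <= x -> 2 * expR (- x) <= eta.
Proof. by move=> h; rewrite ler_wpM2l // ler_expR lerN2. Qed.

Let level_bound D := forall (W : finType) (A : pred W)
    (iota : W -> Xvar n.+1 D.+1 -> X) (rho : omega n D.+1 W -> X -> status)
    (S : pred X) (phi : bpoint X -> F),
  embeds A iota rho -> 1 / 2 <= \sum_(v | A v) dens R (iota v) S ->
  level s D.+1 S phi ->
  avg (fun o => relrank kappa (rho o) S phi) <= (2 * s%:R) ^+ D.+1 * eta.

Lemma avg_relrank_terms (T : finType) (rho : T -> X -> status) S d (e : R)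
    (phi : bpoint X -> F) :
  level s d.+1 S phi ->
  (forall (K : finType) (col : X -> K) (psi : K -> bpoint X -> F),
    (forall k, level s d (fun x => S x && (col x == k)) (psi k)) ->
    avg (fun o => relrank kappa (rho o) S (fun p => \prod_k psi k p)) <= e) ->
  avg (fun o => relrank kappa (rho o) S phi) <= s%:R * e.
Proof.
move=> [c [m [col [psi [phiE lev]]]]] H.
have -> : phi = (fun p => \sum_j c j * \prod_k psi j k p) by apply: funext.
apply: (@le_trans _ _ (avg (fun o => \sum_j
    relrank kappa (rho o) S (fun p => \prod_k psi j k p)))).
  apply: le_avg => o.
  exact: (relrank_sum kappa_gt0 _ _ c (fun j p => \prod_k psi j k p)).
rewrite avg_sum; apply: (@le_trans _ _ (\sum_(j < s) e)).
  by apply: ler_sum => j _; apply: H (lev j).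
by rewrite sumr_const card_ord mulr_natl.
Qed.

Lemma core_bound D : level_bound D.
Proof.
have t1 := t_ge1; have t0 : 0 < t by lra.
have eta0 : 0 <= eta by rewrite mulr_ge0 ?expR_ge0.
have eqM : n.+1%:R / 16 / (64 * t) = t / 1024.
  by rewrite -t2; field; apply/eqP; lra.
have tn : t <= n.+1%:R by rewrite -t2 expr2 ler_peMl //; lra.
elim: D => [|D IH] W A iota rho S phi emb mass lev.
  apply: le_trans (_ : s%:R * eta <= _); last first.
    by have s0 := ler0n R s; rewrite expr1; move: eta0; set x := eta; nra.
  apply: avg_relrank_terms lev _ => K col psi lev.
  have dep k := affine_depends (lev k).
  pose share (w : W * 'I_n.+1) k := dens R (sub_iota iota w) (fun x => S x && (col x == k)).
  have a0 w k : 0 <= share w k by apply: dens_ge0.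
  have a1 w : \sum_k share w k <= 1 by apply: sum_share_le1.
  have massM : n.+1%:R / 2 <= \sum_(w | A w.1) \sum_k share w k.
    by rewrite (sum_share R A iota S col) ler_wpM2l //; lra.
  have [[k tk]|[at_ H]|[at_ H]] := trichotomy t a0 a1 massM.
  - apply: le_trans (avg_relrank_affine kappa_gt0 kappa2 emb dep (lev k) tk) _.
    by apply: le_eta2; lra.
  - apply: le_trans (avg_relrank_parity kappa_gt0 kappa2 emb dep t_ge1 at_ H) _.
    by rewrite eqM le_eta.
  - apply: le_trans (avg_relrank_dominated kappa_gt0 kappa2 emb lev t0 _ at_ H) _.
      by rewrite ltr0n.
    apply: le_eta; rewrite -t2; have -> : 3 * t ^+ 2 / (64 * t) = 3 * t / 64.
      by field; apply/eqP; lra.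
    lra.
set e := (2 * s%:R) ^+ D.+1 * eta in IH.
have e0 : 0 <= e by rewrite mulr_ge0 // exprn_ge0 // mulr_ge0.
(* For positive [s], [eta <= e] and the target is 2 [s] [e]; for [s = 0] the left side vanishes. *)
apply: le_trans (_ : s%:R * (eta + e) <= _); last first.
  have [->|s0] := posnP s; first by rewrite mul0r mulr_ge0 // exprn_ge0 // mulr_ge0.
  have s1 : 1 <= s%:R :> R by rewrite ler1n.
  rewrite exprS -mulrA -/e -mulrA [leRHS]mulrCA ler_wpM2l //.
  rewrite mulr2n mulrDl mul1r lerD2r /e ler_peMl // exprn_ege1 //; lra.
apply: avg_relrank_terms lev _ => K col psi lev.
have dep k := level_depends (lev k).
pose share (w : W * 'I_n.+1) k := dens R (sub_iota iota w) (fun x => S x && (col x == k)).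
have a0 w k : 0 <= share w k by apply: dens_ge0.
have a1 w : \sum_k share w k <= 1 by apply: sum_share_le1.
have massM : n.+1%:R / 2 <= \sum_(w | A w.1) \sum_k share w k.
  by rewrite (sum_share R A iota S col) ler_wpM2l //; lra.
have rec := avg_relrank_rec kappa_gt0 kappa2 dep e0
  (fun b lv k h => IH _ _ _ _ _ _ (embeds_sub emb b lv) h (lev k)).
have [[k tk]|[at_ H]|[at_ H]] := trichotomy t a0 a1 massM.
- apply: le_trans rec _; rewrite lerD2r.
  by apply: le_trans (avg_bad_mass tk) _; apply: le_eta2; lra.
- apply: (@le_trans _ _ eta); last by rewrite lerDl.
  apply: le_trans (avg_relrank_parity kappa_gt0 kappa2 emb dep t_ge1 at_ H) _.
  by rewrite eqM le_eta.
- apply: le_trans rec _; rewrite lerD2r.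
  apply: le_trans (avg_bad_dominated H) _; apply: le_eta; lra.
Qed.

End CoreBound.

(** * The lower bound *)

Section CircuitBound.
Variables (R : realType) (F : fieldType) (n D : nat).
Let m := n.+1.
Let X := 'I_#|Xvar n.+1 D.+1|.

Let iota (_ : unit) (x : Xvar n.+1 D.+1) : X := enum_rank x.
Let rho (o : omega n D.+1 unit) (k : X) : status := restr o tt (enum_val k).

Let embeds_root : embeds predT iota rho.
Proof.
split; first by move=> [] [] y y' /enum_rank_inj.
  by move=> o [] y _; rewrite /rho /iota enum_rankK.
by move=> o o' x /(_ tt (enum_val x) isT); rewrite /iota enum_valK eqxx.
Qed.

(** The pairs ([y], [z]) feed [rank_evmx_pairs], and balance makes the number of live variables
    twice that of pairs. *)
Lemma relrank_Ppoly (kappa : R) o : kappa ^+ 2 = 1 / 2 ->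
  1 <= relrank kappa (rho o) xpredT
    (fun b : bpoint X => mpoly.meval (fun k => (b k)%:R) (Ppoly F n.+1 D.+1)).
Proof.
move=> kappa2; set phi := fun b : bpoint X => _.
pose Y := [pred x | restr o tt x == inr true].
pose ps := [seq (iota tt x, iota tt (partner o tt x)) | x <- enum Y].
have sideE s : side (rho o) xpredT s = side (restr o tt) xpredT s.
  by rewrite /side (reindex _ (onW_bij _ (enum_rank_bij _))) /=;
    apply: eq_bigr => x _; rewrite /rho enum_rankK.
have size_ps : size ps = side (rho o) xpredT true.
  by rewrite size_map -cardE sideE card_side; apply: eq_card.
have mem_ps x : x \in enum Y -> restr o tt x = inr true.
  by rewrite mem_enum => /eqP.
have := @rank_evmx_pairs F X (rho o) phi ps; rewrite size_ps => rk.
rewrite /relrank live_side.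
have -> : side (rho o) xpredT false = side (rho o) xpredT true.
  by rewrite !sideE restr_balanced.
rewrite addnn -mul2n exprM kappa2 expr_div_n expr1n mul1r.
rewrite ler_pdivlMr ?exprn_gt0 // mul1r -natrX ler_nat; apply: rk.
- by rewrite /unzip1 -map_comp map_inj_uniq ?enum_uniq // => x y /enum_rank_inj.
- rewrite /unzip2 -map_comp map_inj_in_uniq ?enum_uniq // => x y xY yY /enum_rank_inj.
  by apply: partner_inj; exact: mem_ps.
move=> a b; rewrite /phi Circuits.Ppoly_eval (Pval_restr (o := o) (w := tt)); last first.
  by move=> x c h; rewrite ffunE /rho enum_rankK h.
rewrite big_map big_enum; apply: eq_bigr => x /eqP Yx.
have xY : restr o tt x = inr true := Yx.
by rewrite !ffunE /rho !enum_rankK xY (restr_partner xY).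
Qed.

Lemma circuit_bound (t : R) (C : circuit F #|Xvar n.+1 D.+1|) :
  1 <= t -> t ^+ 2 = n.+1%:R ->
  multilinear_circuit C -> product_depth_le C D.+1 ->
  computes C (Ppoly F n.+1 D.+1) ->
  expR (t / 1024) <= 2 * (2 * (circuit_size C)%:R) ^+ D.+1.
Proof.
move=> t1 t2 ml pd comp.
pose kappa : R := Num.sqrt (1 / 2).
have kappa2 : kappa ^+ 2 = 1 / 2 by rewrite sqr_sqrtr.
have kappa0 : 0 < kappa by rewrite sqrtr_gt0.
have lev := Circuits.circuit_level ml pd; rewrite comp in lev.
have mass : 1 / 2 <= \sum_(v | predT v) dens R (iota v) xpredT.
  rewrite (big_pred1 tt) => [|[]//].
  by rewrite [leRHS](avg_const (leaf0 n D.+1) 1); lra.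
have : 1 <= (2 * (circuit_size C)%:R) ^+ D.+1 * (2 * expR (- (t / 1024))).
  apply: le_trans (core_bound kappa0 kappa2 t1 t2 embeds_root mass lev).
  rewrite -[leLHS](avg_const (omega_inhabited n D.+1 unit) (1 : R)).
  by apply: le_avg => o; apply: relrank_Ppoly.
by rewrite expRN mulrA ler_pdivlMr ?expR_gt0 // mul1r [leRHS]mulrC.
Qed.

End CircuitBound.

Local Open Scope classical_set_scope.

Theorem theorem4p1 (R : realType) (F : fieldType) (Delta : nat -> nat)
    (Delta_ge1 : forall m : nat, (1 <= Delta m)%N)
    (Delta_small : exists2 e : nat -> R,
       e @ \oo --> (0 : R) &
       \forall m \near \oo, (Delta m)%:R = m%:R `^ (e m) :> R) :
  exists2 c : R, 0 < c &
    \forall m \near \oo,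
      forall C : circuit F #|Xvar m (Delta m)|,
        multilinear_circuit C ->
        product_depth_le C (Delta m) ->
        computes C (Ppoly F m (Delta m)) ->
        expR (m%:R `^ c) <= (circuit_size C)%:R :> R
        /\ expR ((8 * (2 * m) ^ Delta m)%N%:R `^ (c / (Delta m)%:R))
             <= (circuit_size C)%:R :> R.
Proof.
have [e e0 De] := Delta_small.
have e18 : \forall m \near \oo, e m < 1 / 8 by apply: (cvgr_lt 0 e0); lra.
exists (1 / 8); first by lra.
(* With u = m^(1/8), this gives u >= 64, so that u^4/1024 >= 4 u^2 exceeds (2 + 2 u) u; and [e18]
   gives Delta <= u. *)
have big_m : \forall m \near \oo, (64 : R) ^+ 8 <= m%:R by exact: nbhs_infty_ger.
apply: filterS3 De e18 big_m => m; have := Delta_ge1 m.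
case: (Delta m) => // D _ De em m64 C ml pd comp.
set s := circuit_size C.
have m0 : 0 < m%:R :> R by apply: lt_le_trans m64; rewrite exprn_gt0.
case: m m0 De em m64 C ml pd comp @s => [|n]; first by rewrite ltxx.
set M : R := n.+1%:R => M0 De em m64 C ml pd comp s.
pose u : R := M `^ (1 / 8).
have u8 : u ^+ 8 = M.
  rewrite -powR_mulrn ?powR_ge0 // -powRrM.
  have -> : 1 / 8 * 8 = 1 :> R by lra. by rewrite powRr1; [|exact: ltW].
have u0 : 0 <= u by apply: powR_ge0.
have u64 : 64 <= u by rewrite -(@ler_pXn2r _ 8) ?nnegrE // u8.
have Du : D.+1%:R <= u.
  by rewrite De; apply: ler_powR; [rewrite /M ler1n|exact: ltW].
have t1 : 1 <= u ^+ 4 by rewrite exprn_ege1 //; lra.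
have t2 : (u ^+ 4) ^+ 2 = n.+1%:R by rewrite -exprM u8.
have bound := circuit_bound t1 t2 ml pd comp.
(* The factor 2 leaves room for the bound in terms of the number of variables. *)
have s_ge : expR (2 * u) <= s%:R.
  rewrite leNgt; apply/negP => su.
  have four : 4 <= expR 2 :> R.
    have -> : (2 : R) = 1 + 1 by lra.
    by rewrite expRD; have := expR_ge1Dx (1 : R); nra.
  have s4 : 2 * (2 * s%:R) ^+ D.+1 <= (4 * s%:R) ^+ D.+1 :> R.
    have -> : (4 * s%:R : R) = 2 * (2 * s%:R) by rewrite mulrA; congr (_ * _); lra.
    rewrite [leRHS]exprMn ler_wpM2r ?exprn_ge0 ?mulr_ge0 //.
    by rewrite exprS ler_peMr // exprn_ege1 //; lra.
  have s5 : (4 * s%:R) ^+ D.+1 < expR (2 + 2 * u) ^+ D.+1.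
    rewrite ltr_pXn2r ?nnegrE ?mulr_ge0 ?expR_ge0 // expRD.
    by have := expR_gt0 (2 * u); have := ler0n R s; nra.
  have : expR (u ^+ 4 / 1024) < expR ((2 + 2 * u) * u).
    apply: le_lt_trans (le_trans bound s4) (lt_le_trans s5 _).
    by rewrite -expRM_natr ler_expR ler_wpM2l //; lra.
  rewrite ltr_expR; apply/negP; rewrite -leNgt ler_pdivlMr; last by lra.
  have -> : u ^+ 4 = u * u * (u * u) by rewrite !exprS expr0; ring.
  have : 4096 <= u * u by nra.
  have : (2 + 2 * u) * u <= 3 * (u * u) by nra.
  by set v := u * u; set w := _ * u; nra.
split; apply: le_trans s_ge; rewrite ler_expR; first by rewrite -/u; lra.
have D0 : 0 < D.+1%:R :> R by rewrite ltr0n.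
(* Since (2 u)^8 = 256 m, the number of variables 8 (2 m)^Delta is at most (2 u)^(8 Delta), whose
   power 1/(8 Delta) is 2 u. *)
apply: (@le_trans _ _ (((2 * u) ^+ (8 * D.+1)) `^ (1 / 8 / D.+1%:R))).
  apply: ge0_ler_powR; rewrite ?nnegrE ?exprn_ge0 ?mulr_ge0 ?divr_ge0 //.
  rewrite exprM natrM natrX natrM.
  have -> : (2 * u) ^+ 8 = 256 * M by rewrite exprMn u8; congr (_ * _); rewrite !exprS expr0; lra.
  apply: (@le_trans _ _ (8 ^+ D.+1 * (2 * M) ^+ D.+1)).
    apply: ler_wpM2r; first by rewrite exprn_ge0 // mulr_ge0 // ltW.
    by rewrite exprS ler_peMr // exprn_ege1 //; lra.
  rewrite -exprMn lerXn2r ?nnegrE ?mulr_ge0 ?(ltW M0) //; lra.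
rewrite -powR_mulrn ?mulr_ge0 // -powRrM natrM.
have -> : 8 * D.+1%:R * (1 / 8 / D.+1%:R) = 1 :> R by field; apply/eqP; lra.
by rewrite powRr1 // mulr_ge0.
Qed.
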